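(* Let $k$ be a field, $n \ge 3$, and let $G$ be a simple graph on the vertex set $\{1,\dots,n\}$. If $I_G^{(m)}$ is a Cohen-Macaulay ideal for some $m \ge 3$, then $I_G^{(m)}$ is a Cohen-Macaulay ideal for all $m \ge 1$.
   Context: Let $S = k[x_1,\dots,x_n]$ be a polynomial ring. A simple graph here means a finite undirected graph without multiple edges, without loops and without isolated vertices (every vertex in $\{1,\dots,n\}$ belongs to an edge). We write $\{i,j\}\in G$ if $\{i,j\}$ is an edge of $G$. For $i \ne j$ put $P_{ij} = (x_t \mid t \ne i,j)$, the prime ideal of $S$ generated by all variables other than $x_i,x_j$. Define $I_G = \bigcap_{\{i,j\}\in G} P_{ij}$ and its $m$-th symbolic power $I_G^{(m)} = \bigcap_{\{i,j\}\in G} P_{ij}^m$. An ideal $I$ of $S$ is called Cohen-Macaulay if $S/I$ is a Cohen-Macaulay ring. *)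

(* Defs.v *)
From HB Require Import structures.
From mathcomp Require Import all_boot all_order all_algebra.
From mathcomp Require Import ring_quotient.
From mathcomp Require Import mpoly.

Set Implicit Arguments.
Unset Strict Implicit.
Unset Printing Implicit Defensive.

Import GRing.Theory.
Local Open Scope ring_scope.

(* The proper ideals and the prime ideals of a ring are the library's [idealr]
   and [prime_idealr]. Their membership is boolean: with classical logic and
   choice every proper ideal has this form. *)

Section CohenMacaulay.

Variable R : comNzRingType.

Definition ideal_gen (X : R -> Prop) (x : R) : Prop :=
  exists s : seq (R * R),
    (forall u, u \in s -> X u.2) /\ x = \sum_(u <- s) u.1 * u.2.

(* The 0-th power is the unit ideal, because the empty product is 1. *)
Definition ideal_pow (I : R -> Prop) (m : nat) : R -> Prop :=
  ideal_gen (fun x => exists a : 'I_m -> R,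
                        (forall i, I (a i)) /\ x = \prod_(i < m) a i).

Definition noetherian : Prop :=
  forall I : idealr R, exists s : seq R,
    forall x, x \in I <-> ideal_gen (fun y => y \in s) x.

Definition maximal_ideal (M : idealr R) : Prop :=
  forall J : idealr R, {subset M <= J} -> {subset J <= M}.

Definition prime_chain (M : idealr R) (d : nat) : Prop :=
  exists p : nat -> prime_idealr R,
    (forall i, (i < d)%N ->
       {subset p i <= p i.+1} /\ ~ {subset p i.+1 <= p i}) /\
    p d =i M.

Definition codim_eq (M : idealr R) (d : nat) : Prop :=
  prime_chain M d /\ forall e, prime_chain M e -> (e <= d)%N.

Definition regular_seq (s : seq R) : Prop :=
  (forall i y, (i < size s)%N ->
     ideal_gen (fun z => z \in take i s) (s`_i * y) ->
     ideal_gen (fun z => z \in take i s) y) /\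
  ~ ideal_gen (fun z => z \in s) 1.

Definition depth_eq (M : idealr R) (d : nat) : Prop :=
  (exists s : seq R, [/\ regular_seq s, {subset s <= M} & size s = d]) /\
  forall s : seq R, regular_seq s -> {subset s <= M} -> (size s <= d)%N.

(* D. Eisenbud, Commutative Algebra, Section 18.2: depth(M, R) = codim M for
   every maximal ideal M of the noetherian ring R. *)
Definition cohen_macaulay_ring : Prop :=
  noetherian /\
  forall M : idealr R, maximal_ideal M ->
    exists d : nat, depth_eq M d /\ codim_eq M d.

End CohenMacaulay.

(* [J] is [I] with its structure of a proper ideal, which [{ideal_quot J}]
   requires; it is determined by [I]. *)
Definition cohen_macaulay_ideal (R : comNzRingType) (I : R -> Prop) : Prop :=
  exists J : idealr R,
    (forall x, x \in J <-> I x) /\ cohen_macaulay_ring {ideal_quot J}.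

Definition simple_graph (V : finType) (G : rel V) : Prop :=
  [/\ ssrbool.symmetric G, irreflexive G & forall i, exists j, G i j].

Section SymbolicPower.

Variables (k : fieldType) (n : nat).

Definition edge_prime (i j : 'I_n) : {mpoly k[n]} -> Prop :=
  ideal_gen (fun f => exists t : 'I_n, [/\ t != i, t != j & f = 'X_t]).

Definition symbolic_power (G : rel 'I_n) (m : nat) (f : {mpoly k[n]}) : Prop :=
  forall i j : 'I_n, G i j -> ideal_pow (edge_prime i j) m f.

End SymbolicPower.

Arguments symbolic_power k [n] G m f.

(* Main.v *)
(* The ideal I_G^(m) is spanned by monomials: x^a lies in P_ij^m iff the
   exponents of a off {i,j} add up to at least m. Let G_a be the set of the
   edges ij with x^a not in P_ij^m. The cokernel of S/I_G^(m) -> (+) S/P_ij^m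
   has in degree a the functions on G_a modulo the constants, and depth 2 means
   that no G_a is a union of two vertex-disjoint nonempty parts. Both
   implications pass through the condition that any two disjoint edges of G lie
   in a 4-cycle.

   If ab and cd lie in no 4-cycle, the edges between them have a common vertex,
   say a; for m >= 3 and x^w = x_b^(m-1) x_c x_d the edge cd is a component of
   G_w and ab is in G_w. The family equal to x^w on cd and to 0 elsewhere is
   killed by powers of the maximal ideal modulo S/I_G^(m), which a regular pair
   in that ideal forbids.

   Conversely, if ab and cd are in G_a and ac, bd are edges, one of ac, bd is in
   G_a. Let M be a maximal ideal of S/I_G^(m). By the Nullstellensatz there is a
   monic p, divisible by x, with all y_t = p(x_t) in M, and the elementary
   symmetric functions e_1(y), e_2(y) form a regular sequence: on each edge they
   do, and solutions on the edges glue because e_1(y) is regular modulo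
   P_ij^m + P_il^m. Depth and codimension are at most 2, since any three
   elements satisfy a nonzero polynomial relation. *)

Require Import Defs.
From HB Require Import structures.
From mathcomp Require Import all_boot all_order all_algebra.
From mathcomp Require Import ring_quotient.
From mathcomp Require Import mpoly.
From mathcomp Require Import ring zify.
From Stdlib Require Import Classical ClassicalEpsilon.

Set Implicit Arguments.
Unset Strict Implicit.
Unset Printing Implicit Defensive.

Import Order.TTheory GRing.Theory.
Local Open Scope ring_scope.
Local Open Scope quotient_scope.

(** * Ideals of a commutative ring as predicates *)

Section Ideals.

Variable R : comNzRingType.
Implicit Types (K : R -> Prop) (M : idealr R).

Definition is_ideal K : Prop :=
  [/\ K 0, forall x y, K x -> K y -> K (x + y) & forall a x, K x -> K (a * x)].

Lemma idealD K x y : is_ideal K -> K x -> K y -> K (x + y).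
Proof. by case=> _ h _; apply: h. Qed.

Lemma idealM K a x : is_ideal K -> K x -> K (a * x).
Proof. by case=> _ _; apply. Qed.

Lemma idealMl K a x : is_ideal K -> K x -> K (x * a).
Proof. by rewrite mulrC; apply: idealM. Qed.

Lemma idealN K x : is_ideal K -> K x -> K (- x).
Proof. by rewrite -mulN1r; apply: idealM. Qed.

Lemma idealB K x y : is_ideal K -> K x -> K y -> K (x - y).
Proof. by move=> hK hx hy; apply: idealD => //; apply: idealN. Qed.

Lemma ideal_sum K (I : eqType) (r : seq I) (F : I -> R) :
  is_ideal K -> (forall i, i \in r -> K (F i)) -> K (\sum_(i <- r) F i).
Proof.
move=> hK hF; rewrite big_seq; apply: (big_ind K) => //; first by case: hK.
by move=> x y; apply: idealD.
Qed.

Lemma ideal_subK K x y : is_ideal K -> K (x - y) -> K y -> K x.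
Proof. by move=> hK hxy hy; rewrite -(subrK y x); apply: idealD. Qed.

Lemma idealr_is_ideal M : is_ideal (fun x => x \in M).
Proof.
split=> [|x y|a x]; [exact: idealr0|exact: rpredD|exact: idealMr].
Qed.

Lemma ideal_gen_ideal (X : R -> Prop) : is_ideal (ideal_gen X).
Proof.
split.
- by exists [::]; rewrite big_nil.
- move=> x y [s [hs ->]] [t [ht ->]]; exists (s ++ t); split; last by rewrite big_cat.
  by move=> u; rewrite mem_cat => /orP[/hs|/ht].
- move=> a x [s [hs ->]]; exists [seq (a * u.1, u.2) | u <- s]; split.
    by move=> _ /mapP[u /hs us ->].
  by rewrite big_map mulr_sumr; apply: eq_bigr => u _; rewrite mulrA.
Qed.

Lemma mem_ideal_gen (X : R -> Prop) x : X x -> ideal_gen X x.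
Proof.
move=> hx; exists [:: (1, x)]; rewrite big_seq1 mul1r; split=> // u.
by rewrite inE => /eqP->.
Qed.

Lemma ideal_gen_min (X : R -> Prop) K :
  is_ideal K -> (forall x, X x -> K x) -> forall x, ideal_gen X x -> K x.
Proof.
move=> hK hX x [s [hs ->]]; apply: ideal_sum => // u /hs hu.
by apply: idealM => //; apply: hX.
Qed.

Lemma ideal_gen_nil x : ideal_gen (fun z : R => z \in [::]) x <-> x = 0.
Proof.
split=> [|->]; last by case: (ideal_gen_ideal (fun z : R => z \in [::])).
apply: (@ideal_gen_min _ (fun y => y = 0)) => //.
by split=> // [? ? -> ->|? ? ->]; rewrite (addr0, mulr0).
Qed.

Lemma ideal_gen_rcons (s : seq R) a x :
  ideal_gen (fun z => z \in rcons s a) x <->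
  exists c, ideal_gen (fun z => z \in s) (x - c * a).
Proof.
have hs := ideal_gen_ideal (fun z => z \in s); split; last first.
  case=> c; have hr := ideal_gen_ideal (fun z => z \in rcons s a).
  move=> h; apply: (@ideal_subK _ _ (c * a)) => //.
    apply: ideal_gen_min h => // y ys; apply: mem_ideal_gen.
    by rewrite mem_rcons inE ys orbT.
  by apply: idealM => //; apply: mem_ideal_gen; rewrite mem_rcons inE eqxx.
apply: (@ideal_gen_min _ (fun x => exists c, ideal_gen (fun z => z \in s) (x - c * a))).
  split.
  - by exists 0; rewrite mul0r subr0; case: hs.
  - move=> y z [c hc] [d hd]; exists (c + d).
    by rewrite (_ : _ - _ = (y - c * a) + (z - d * a)); [apply: idealD|ring].
  - move=> b y [c hc]; exists (b * c).
    by rewrite (_ : _ - _ = b * (y - c * a)); [apply: idealM|ring].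
move=> y; rewrite mem_rcons inE => /orP[/eqP->|ys].
  by exists 1; rewrite mul1r subrr; case: hs.
by exists 0; rewrite mul0r subr0; apply: mem_ideal_gen.
Qed.

(** Membership in an [idealr] is boolean, so a propositional ideal is decided classically. *)
Definition asb (P : Prop) : bool :=
  if excluded_middle_informative P then true else false.

Lemma asbP (P : Prop) : asb P <-> P.
Proof. by rewrite /asb; case: excluded_middle_informative. Qed.

Lemma asb_ideal_closed K :
  is_ideal K -> ~ K 1 -> idealr_closed (fun x => asb (K x)).
Proof.
move=> hK h1; split.
- by apply/asbP; case: hK.
- by apply/negP => /asbP.
- move=> a u v /asbP hu /asbP hv; apply/asbP.
  by apply: idealD => //; apply: idealM.
Qed.

Lemma idealr_of K : is_ideal K -> ~ K 1 ->
  exists J : idealr R, forall x, x \in J <-> K x.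
Proof.
move=> hK h1; pose S : R -> bool := fun x => asb (K x).
pose J : idealr R := HB.pack S (isIdealr.Build R S (asb_ideal_closed hK h1)).
by exists J => x; apply: asbP.
Qed.

Lemma prime_idealr_of K : is_ideal K -> ~ K 1 ->
  (forall x y, K (x * y) -> K x \/ K y) ->
  exists J : prime_idealr R, forall x, x \in J <-> K x.
Proof.
move=> hK h1 hp; pose S : R -> bool := fun x => asb (K x).
have hS : prime_idealr_closed S.
  by move=> u v /asbP/hp[h|h]; apply/orP; [left|right]; apply/asbP.
pose J : prime_idealr R := HB.pack S
  (isIdealr.Build R S (asb_ideal_closed hK h1)) (isPrimeIdealrClosed.Build R S hS).
by exists J => x; apply: asbP.
Qed.

Lemma maximal_inv M : maximal_ideal M ->
  forall u, u \notin M -> exists h, u * h - 1 \in M.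
Proof.
move=> hM u uM; apply: NNPP => hn.
have hMi := idealr_is_ideal M.
(* [K] is the ideal M + (u); were it proper, maximality would put [u] in [M]. *)
pose K x := exists h, x - u * h \in M.
have hK : is_ideal K.
  split.
  - by exists 0; rewrite mulr0 subr0 idealr0.
  - move=> x y [a ha] [b hb]; exists (a + b).
    by rewrite (_ : _ - _ = (x - u * a) + (y - u * b)); [exact: rpredD|ring].
  - move=> c x [a ha]; exists (c * a).
    by rewrite (_ : _ - _ = c * (x - u * a)); [exact: idealMr|ring].
have hK1 : ~ K 1.
  by case=> h hh; apply: hn; exists h; rewrite -opprB; apply: rpredNr.
have [J hJ] := idealr_of hK hK1.
have sMJ : {subset M <= J}.
  by move=> x xM; apply/hJ; exists 0; rewrite mulr0 subr0.
have /(hM J sMJ) : u \in J by apply/hJ; exists 1; rewrite mulr1 subrr idealr0.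
by rewrite (negbTE uM).
Qed.

(* The witness is the lowest nonzero coefficient of [Q]: mod [K], [Q(s) = 0] can
   be divided by powers of [s], and the rest reduces to it mod [K']. *)
Lemma lowest_coef (A : nzRingType) (ev : {rmorphism A -> R}) K K' (s : R)
    (Q : {poly A}) :
  is_ideal K -> is_ideal K' -> (forall x, K x -> K' x) -> K' s ->
  (forall u, K (s * u) -> K u) ->
  Q != 0 -> K (map_poly ev Q).[s] -> exists2 c, c != 0 & K' (ev c).
Proof.
move=> hK hK' sKK' hs hreg; elim/poly_ind: Q => [|Q c IH]; first by rewrite eqxx.
rewrite rmorphD rmorphM /= map_polyX map_polyC /= !hornerE => nz hQ.
have [c0|c0] := eqVneq c 0.
  have nzQ : Q != 0.
    by apply: contraNneq nz => ->; rewrite c0 mul0r add0r polyC0.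
  by apply: IH => //; apply: hreg; rewrite mulrC -[_ * s]addr0 -(rmorph0 ev) -c0.
exists c => //; rewrite -(addrK ((map_poly ev Q).[s] * s) (ev c)).
by apply: idealB; [|apply: sKK'; rewrite addrC|apply: idealM].
Qed.

(** As [F] is monic, the top coefficient of [F * V] is that of [V], so it lies in [K]; subtracting
    the leading term of [V] shortens [V] and keeps the hypothesis. *)
Lemma monic_mul_coef K (F V : {poly R}) : is_ideal K -> F \is monic ->
  (forall l, ((size F).-1 <= l)%N -> K (F * V)`_l) -> forall l, K V`_l.
Proof.
move=> hK hF; move: {2}(size V) (leqnn (size V)) => N.
elim: N V => [|N IH] V hV hFV l.
  by move: hV; rewrite leqn0 size_poly_eq0 => /eqP->; rewrite coef0; case: hK.
have [->|nz] := eqVneq V 0; first by rewrite coef0; case: hK.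
have hlead : K (lead_coef V).
  rewrite -(lead_coef_monicM V hF); apply: hFV; rewrite size_monicM //.
  by rewrite -size_poly_gt0 in nz; lia.
pose W := V - lead_coef V *: 'X^((size V).-1).
have hW : forall l, K W`_l.
  apply: IH => [|j hj]; rewrite /W.
    rewrite -ltnS; apply: leq_trans hV; rewrite -size_poly_gt0 in nz.
    rewrite -[X in (_ < X)%N](prednK nz) ltnS.
    apply/leq_sizeP => j hj; rewrite coefB coefZ coefXn.
    move: hj; rewrite leq_eqVlt => /orP[/eqP<-|hj].
      by rewrite eqxx mulr1 subrr.
    rewrite gtn_eqF // mulr0 subr0 nth_default //.
    by move: hj; case: (size V).
  rewrite mulrBr coefB; apply: idealB => //; first exact: hFV.
  by rewrite -scalerAr coefZ; apply: idealMl.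
rewrite -(subrK (lead_coef V *: 'X^((size V).-1)) V) coefD; apply: idealD => //.
by rewrite coefZ; apply: idealMl.
Qed.

End Ideals.

(** * Dickson's lemma on exponent vectors *)

Section Dickson.

Variable n : nat.
Implicit Types (a b : 'X_{1..n}) (P : 'X_{1..n} -> Prop).

(** Induction on the number [k] of coordinates compared. A basis for the first [k] still serves
    where the next coordinate reaches its maximum [N] over that basis; below [N] there are finitely
    many slices, each with its own basis. *)
Lemma dickson_prefix k P : exists s : seq 'X_{1..n},
  (forall b, b \in s -> P b) /\
  forall a, P a -> exists2 b, b \in s & forall t : 'I_n, (t < k)%N -> (b t <= a t)%N.
Proof.
elim: k P => [|k IH] P.
  have [[a Pa]|hn] := classic (exists a, P a); last first.
    by exists [::]; split=> // a Pa; case: hn; exists a.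
  exists [:: a]; split=> [b|b _]; first by rewrite inE => /eqP->.
  by exists a; rewrite ?inE.
have [hkn|hkn] := ltnP k n; last first.
  have [s [hs hP]] := IH P; exists s; split=> // a /hP[b bs hb].
  by exists b => // t _; apply: hb; apply: leq_trans hkn.
pose kk := Ordinal hkn.
have [s [hs hP]] := IH P.
pose N := (\max_(b <- s) b kk)%N.
have slices m : exists s' : seq 'X_{1..n}, (forall b, b \in s' -> P b) /\
    forall a, P a -> (a kk < m)%N ->
    exists2 b, b \in s' & forall t : 'I_n, (t < k.+1)%N -> (b t <= a t)%N.
  elim: m => [|m [s' [hs' hP']]]; first by exists [::].
  have [u [hu hPu]] := IH (fun a => P a /\ a kk = m).
  exists (s' ++ u); split=> [b|a Pa].
    by rewrite mem_cat => /orP[/hs'|/hu[]].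
  rewrite ltnS leq_eqVlt => /orP[/eqP am|/(hP' _ Pa)[b bs hb]]; last first.
    by exists b; rewrite // mem_cat bs.
  have [b bu hb] := hPu _ (conj Pa am).
  exists b; first by rewrite mem_cat bu orbT.
  move=> t; rewrite ltnS leq_eqVlt => /orP[/eqP tk|]; last exact: hb.
  have -> : t = kk by apply: val_inj.
  by rewrite am; case: (hu _ bu) => _ ->.
have [s' [hs' hP']] := slices N.
exists (s ++ s'); split=> [b|a Pa].
  by rewrite mem_cat => /orP[/hs|/hs'].
have [aN|Na] := ltnP (a kk) N.
  by have [b bs hb] := hP' _ Pa aN; exists b; rewrite // mem_cat bs orbT.
have [b bs hb] := hP _ Pa; exists b; first by rewrite mem_cat bs.
move=> t; rewrite ltnS leq_eqVlt => /orP[/eqP tk|]; last exact: hb.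
have -> : t = kk by apply: val_inj.
apply: leq_trans Na; rewrite /N (big_rem b) //=; exact: leq_maxl.
Qed.

Lemma dickson P : exists s : seq 'X_{1..n},
  (forall b, b \in s -> P b) /\ forall a, P a -> exists2 b, b \in s & (b <= a)%MM.
Proof.
have [s [hs hP]] := dickson_prefix n P; exists s; split=> // a /hP[b bs hb].
by exists b => //; apply/mnm_lepP => t; apply: hb.
Qed.

End Dickson.

(** * Hilbert's basis theorem for polynomials over a field *)

Section Hilbert.

Variables (k : fieldType) (n : nat).
Implicit Types (f g : {mpoly k[n]}).

(** Elements of [K] whose leading exponents form a Dickson basis of all leading exponents generate
    [K]: subtracting a multiple of one of them lowers the leading exponent. *)
Lemma hilbert_basis (K : {mpoly k[n]} -> Prop) : is_ideal K ->
  exists s : seq {mpoly k[n]}, forall x, K x <-> ideal_gen (fun y => y \in s) x.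
Proof.
move=> hK.
have [s [hs hlead]] := dickson (fun a => exists f, [/\ K f, f != 0 & mlead f = a]).
have [gs [hgs hs']] : exists gs : seq {mpoly k[n]}, (forall g, g \in gs -> K g) /\
    forall b, b \in s -> exists g, [/\ g \in gs, g != 0 & mlead g = b].
  elim: s hs {hlead} => [|b s IH] hs; first by exists [::].
  have [|gs [h1 h2]] := IH; first by move=> c cs; apply: hs; rewrite inE cs orbT.
  have [|g [Kg g0 gb]] := hs b; first by rewrite inE eqxx.
  exists (g :: gs); split=> [h|c]; first by rewrite inE => /orP[/eqP->|/h1].
  rewrite inE => /orP[/eqP->|/h2[h [hh h0 hc]]].
    by exists g; rewrite inE eqxx.
  by exists h; rewrite inE hh orbT.
have hG := ideal_gen_ideal (fun y => y \in gs).
exists gs => x; split; last first.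
  by apply: ideal_gen_min => //.
elim/mleadrect: x => x IH Kx.
have [->|x0] := eqVneq x 0; first by case: hG.
have [|b bs bx] := hlead (mlead x); first by exists x.
have [g [gg g0 gb]] := hs' _ bs.
pose c := mleadc x / mleadc g.
have c0 : c != 0 by rewrite mulf_neq0 ?invr_eq0 ?mleadc_eq0.
pose h := c *: 'X_[mlead x - b] * g.
have hX : c *: 'X_[mlead x - b] != 0 :> {mpoly k[n]}.
  by rewrite mscalerI negb_or c0 -msize_poly_eq0 msizeX.
have hlx : mlead h = mlead x.
  by rewrite /h mleadM // mleadZ // mleadXm gb submK.
have hc : h@_(mlead x) = mleadc x.
  rewrite -[in LHS]hlx /h mleadM // mleadcM mleadcZE mleadXm mcoeffX eqxx mulr1.
  by rewrite divfK // mleadc_eq0.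
have Gh : ideal_gen (fun y => y \in gs) h.
  by apply: idealM => //; apply: mem_ideal_gen.
have [/eqP xh|nz] := eqVneq (x - h) 0; first by rewrite subr_eq0 in xh; rewrite (eqP xh).
apply: (@ideal_subK _ _ _ h) => //; apply: IH; last first.
  by apply: idealB => //; apply: idealM => //; apply: hgs.
rewrite lt_neqAle; apply/andP; split.
  by apply: contraNneq nz => e; rewrite -mleadc_eq0 e mcoeffB hc subrr.
by apply: le_trans (mleadB_le _ _) _; rewrite hlx joinxx.
Qed.

End Hilbert.

(** * Monomial ideals *)

Section MonomialIdeals.

Variables (k : fieldType) (n : nat).
Implicit Types (f g u : {mpoly k[n]}) (a b : 'X_{1..n}) (D : pred 'X_{1..n}).

Definition upclosed D := forall a b, D a -> D (a + b)%MM.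

Definition mono_ideal D f : Prop := forall a, f@_a != 0 -> D a.

Lemma mono_idealX D a : D a -> mono_ideal D ('X_[a] : {mpoly k[n]}).
Proof. by move=> Da b; rewrite mcoeffX; case: (a =P b) => [<- //|_]; rewrite eqxx. Qed.

Lemma mcoeff_mul_neq0 f g a : (f * g)@_a != 0 ->
  exists b c, [/\ f@_b != 0, g@_c != 0 & a = (b + c)%MM].
Proof.
rewrite -mcoeff_msupp => /msuppM_le/allpairsP[[b c] /= [hb hc ->]].
by exists b, c; rewrite -!mcoeff_msupp.
Qed.

Lemma mono_ideal_ideal D : upclosed D -> is_ideal (@mono_ideal D).
Proof.
move=> hD; split=> [a|f g hf hg a|f g hg a].
- by rewrite mcoeff0 eqxx.
- rewrite mcoeffD; have [->|] := eqVneq f@_a 0; last by move=> /hf.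
  by rewrite add0r => /hg.
- by move=> /mcoeff_mul_neq0[b [c [_ /hg Dc ->]]]; rewrite addmC; apply: hD.
Qed.

Lemma mcoeffM_unique f g b c :
  (forall b' c', f@_b' != 0 -> g@_c' != 0 -> (b + c = b' + c')%MM -> b' = b) ->
  (f * g)@_(b + c) = f@_b * g@_c.
Proof.
move=> h; rewrite mcoeffM.
have hb : (mdeg b < (mdeg (b + c)).+1)%N by rewrite mdegD ltnS leq_addr.
have hc : (mdeg c < (mdeg (b + c)).+1)%N by rewrite mdegD ltnS leq_addl.
rewrite (bigD1 (BMultinom hb, BMultinom hc)) /= ?eqxx //.
rewrite big1 ?addr0 // => -[[b' hb'] [c' hc']] /= /andP[/eqP e ne].
apply: contraNeq ne; rewrite mulf_eq0 negb_or => /andP[fb gc].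
have eb := h _ _ fb gc e; subst b'; apply/eqP; congr (_, _); apply: val_inj => //=.
by apply: (@addmI _ b); rewrite e.
Qed.

(** The minimum is for the order that compares weights first and breaks ties by the monomial order;
    both are well founded. *)
Lemma ex_min_mnm (w : 'X_{1..n} -> nat) (P : 'X_{1..n} -> Prop) :
  (exists a, P a) -> exists a, P a /\
    forall b, P b -> (w a <= w b)%N /\ (w b = w a -> (a <= b)%O).
Proof.
case=> a0 Pa0.
have [m [[a1 [Pa1 am]] hm]] :
    exists m, (exists a, P a /\ w a = m) /\ forall b, P b -> (m <= w b)%N.
  elim/ltn_ind: (w a0) {-2}a0 (erefl (w a0)) Pa0 => m IH a am Pa.
  have [[b [Pb bm]]|hn] := classic (exists b, P b /\ (w b < m)%N).
    by apply: (IH _ bm b).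
  exists m; split; first by exists a.
  by move=> b Pb; rewrite leqNgt; apply/negP => bm; apply: hn; exists b.
elim/(@ltmwf n): a1 Pa1 am => a IH Pa am.
have [[b [Pb [bm ba]]]|hn] := classic (exists b, P b /\ w b = m /\ (b < a)%O).
  exact: (IH b).
exists a; split=> // b Pb; rewrite am; split; first exact: hm.
by move=> bm; rewrite leNgt; apply/negP => ba; apply: hn; exists b.
Qed.

(* Comparing the lowest terms with respect to the weight [w]; the monomials
   of weight 0 are the ones that are invertible modulo the ideal. *)
Lemma mono_ideal_reg D (w : 'X_{1..n} -> nat) f u :
  upclosed D -> (forall a b, w (a + b)%MM = w a + w b)%N ->
  (forall a b, w a = 0 -> D (a + b)%MM -> D b)%N ->
  (exists2 a, f@_a != 0 & w a = 0%N) ->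
  mono_ideal D (f * u) -> mono_ideal D u.
Proof.
move=> hD wD w0D [a0 fa0 wa0] hfu a ua; apply/negPn/negP => nDa.
have hid := mono_ideal_ideal hD.
(* [v] is [u] without its terms in the ideal, so every exponent of [v] is outside [D]. *)
pose v := u - \sum_(b <- msupp u | D b) u@_b *: 'X_[b].
have vE b : v@_b = if D b then 0 else u@_b.
  rewrite mcoeffB raddf_sum /=.
  have [bu|bu] := boolP (b \in msupp u); last first.
    rewrite big_seq_cond big1 ?subr0 => [|c /andP[cu _]].
      by rewrite (memN_msupp_eq0 bu) if_same.
    rewrite mcoeffZ mcoeffX; case: eqP => [e|]; rewrite ?mulr0 //.
    by rewrite -e cu in bu.
  rewrite big_mkcond (bigD1_seq b) //= ?msupp_uniq // big1 => [|c cb]; last first.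
    by case: ifP => // _; rewrite mcoeffZ mcoeffX (negbTE cb) mulr0.
  by rewrite addr0; case: ifP => _; rewrite ?subr0 // mcoeffZ mcoeffX eqxx mulr1 subrr.
have hfv : mono_ideal D (f * v).
  rewrite mulrBr; apply: (idealB hid) => //; apply: (idealM _ hid) => b.
  apply: contraNT => nDb; rewrite raddf_sum big1 //= => c Dc.
  rewrite mcoeffZ mcoeffX; case: eqP => [e|]; rewrite ?mulr0 //.
  by rewrite e (negbTE nDb) in Dc.
have [b [fb hb]] : exists b, (f@_b != 0 /\ w b = 0%N) /\
    forall c, f@_c != 0 /\ w c = 0%N -> (b <= c)%O.
  have [|b [fb hb]] := @ex_min_mnm w (fun b => f@_b != 0 /\ w b = 0%N).
    by exists a0.
  exists b; split=> // c [fc wc].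
  by have [_] := hb _ (conj fc wc); apply; rewrite wc fb.2.
have [|c [vc hc]] := @ex_min_mnm w (fun c => v@_c != 0).
  by exists a; rewrite vE (negbTE nDa).
have nDc : ~~ D c by apply: contraNN vc => Dc; rewrite vE Dc.
case: fb => fb wb; move: nDc; rewrite (w0D b) //; apply: hfv.
rewrite mcoeffM_unique ?mulf_neq0 // => b' c' fb' vc' e.
have [wc hc'] := hc _ vc'.
have := wD b c; rewrite e wD wb add0n => ew.
have wb' : w b' = 0%N by lia.
have cc' : (c <= c')%O by apply: hc'; lia.
have bb' : (b <= b')%O by apply: hb.
apply/eqP; rewrite eq_le bb' andbT leNgt; apply/negP => lbb'.
by have := ltmc_le_add lbb' cc'; rewrite e ltxx.
Qed.

End MonomialIdeals.

(** * Powers of the edge primes, and gluing along edges *)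

Section EdgeIdeals.

Variables (k : fieldType) (n : nat).
Implicit Types (f g u : {mpoly k[n]}) (a b : 'X_{1..n}) (T : {set 'I_n}) (i j t : 'I_n).

(** For [T] = {i, j} this is the largest m such that x^a lies in P_ij^m. *)
Definition off T a : nat := (\sum_(t | t \notin T) a t)%N.

Lemma offD T a b : (off T (a + b)%MM = off T a + off T b)%N.
Proof. by rewrite /off -big_split; apply: eq_bigr => t _; rewrite mnmDE. Qed.

Lemma off_U T t : off T U_(t)%MM = (t \notin T).
Proof.
rewrite /off; case: (boolP (t \in T)) => tT; last first.
  rewrite (bigD1 t) //= mnm1E eqxx big1 ?addn0 // => s /andP[_ st].
  by rewrite mnm1E eq_sym (negbTE st).
by rewrite big1 // => s sT; rewrite mnm1E; case: (t =P s) => // e; rewrite -e tT in sT.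
Qed.

Lemma off_subset T T' a : T \subset T' -> (off T' a <= off T a)%N.
Proof.
move=> sTT'; rewrite /off [leqRHS]big_mkcond [leqLHS]big_mkcond /=.
apply: leq_sum => t _; case: (boolP (t \in T')) => // tT'.
by have -> : t \notin T by apply: contraNN tT' => /(subsetP sTT').
Qed.

Lemma off_set2 i j a : i != j -> (off [set i; j] a + a i + a j = mdeg a)%N.
Proof.
move=> ij; have -> : off [set i; j] a = (\sum_(t | (t != i) && (t != j)) a t)%N.
  by apply: eq_bigl => t; rewrite !inE negb_or.
rewrite [mdeg a]mdegE (bigD1 (P := xpredT) i) //=.
have ji : j != i by rewrite eq_sym.
by rewrite (bigD1 (P := fun t => t != i) j ji) /= addnA [RHS]addnC addnA.
Qed.

(** P_ij^m described by its monomials; [ideal_pow_edgeE] matches it with the power of the ideal. For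
    i = j and [m] = 1 it is the prime of a coordinate axis. *)
Definition edge_ideal m i j : {mpoly k[n]} -> Prop :=
  mono_ideal (fun a => (m <= off [set i; j] a)%N).

Lemma off_upclosed m T : upclosed (fun a => (m <= off T a)%N).
Proof. by move=> a b h; rewrite offD; apply: leq_trans (leq_addr _ _). Qed.

Lemma edge_ideal_ideal m i j : is_ideal (edge_ideal m i j).
Proof. exact: mono_ideal_ideal (@off_upclosed m _). Qed.

Lemma edge_idealC m i j f : edge_ideal m i j f -> edge_ideal m j i f.
Proof. by rewrite /edge_ideal setUC. Qed.

Lemma edge_ideal_mul m m' i j f g :
  edge_ideal m i j f -> edge_ideal m' i j g -> edge_ideal (m + m') i j (f * g).
Proof.
move=> hf hg a /mcoeff_mul_neq0[b [c [/hf hb /hg hc ->]]].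
by rewrite offD leq_add.
Qed.

Lemma edge_ideal0 i j f : edge_ideal 0 i j f.
Proof. by move=> a _. Qed.

Lemma edge_idealW m m' i j f : (m' <= m)%N -> edge_ideal m i j f -> edge_ideal m' i j f.
Proof. by move=> h hf a /hf; apply: leq_trans. Qed.

Lemma edge_ideal_exp m i j f : edge_ideal 1 i j f -> edge_ideal m i j (f ^+ m).
Proof.
move=> hf; elim: m => [|m IH]; first exact: edge_ideal0.
by rewrite exprS; apply: (edge_ideal_mul hf IH).
Qed.

Lemma edge_idealX m i j a :
  (m <= off [set i; j] a)%N -> edge_ideal m i j 'X_[a].
Proof. by move=> h; apply: mono_idealX. Qed.

Lemma edge_idealU i j t : t != i -> t != j -> edge_ideal 1 i j 'X_t.
Proof. by move=> ti tj; apply: edge_idealX; rewrite off_U !inE negb_or ti tj. Qed.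

Lemma ideal_powS (K : {mpoly k[n]} -> Prop) m x y :
  K x -> ideal_pow K m y -> ideal_pow K m.+1 (x * y).
Proof.
move=> Kx; have hid := ideal_gen_ideal (fun x => exists a : 'I_m.+1 -> {mpoly k[n]},
  (forall l : 'I_m.+1, K (a l)) /\ x = \prod_(l < m.+1) a l).
apply: (@ideal_gen_min _ _ (fun y => ideal_pow K m.+1 (x * y))).
  split=> [|u v hu hv|c u hu]; rewrite ?mulr0 ?mulrDr 1?mulrCA.
  - by case: hid.
  - exact: (idealD hid).
  - exact: (idealM _ hid).
move=> _ [a [ha ->]]; apply: mem_ideal_gen.
exists (fun l : 'I_m.+1 => if unlift ord0 l is Some l' then a l' else x); split.
  by move=> l; case: unliftP.
by rewrite big_ord_recl unlift_none; congr (_ * _); apply: eq_bigr => l _; rewrite liftK.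
Qed.

Lemma ideal_pow_edgeE m i j f : ideal_pow (edge_prime i j) m f <-> edge_ideal m i j f.
Proof.
have prime_edge g : edge_prime i j g -> edge_ideal 1 i j g.
  apply: ideal_gen_min => [|_ [t [ti tj ->]]]; first exact: edge_ideal_ideal.
  exact: edge_idealU.
split.
  apply: ideal_gen_min => [|_ [a [ha ->]]]; first exact: edge_ideal_ideal.
  elim: m a ha => [|m IH] a ha; first exact: edge_ideal0.
  rewrite big_ord_recl; apply: (@edge_ideal_mul 1 m); first exact: prime_edge.
  exact: IH.
move=> hf; rewrite (mpolyE f).
have hid := ideal_gen_ideal (fun x => exists a : 'I_m -> {mpoly k[n]},
  (forall l : 'I_m, edge_prime i j (a l)) /\ x = \prod_(l < m) a l).
apply: (ideal_sum hid) => a; rewrite mcoeff_msupp => /hf ha.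
rewrite -mul_mpolyC; apply: (idealM _ hid).
elim: m a ha {hf hid} => [|m IH] a ha.
  rewrite -['X_[a]]mulr1; apply: idealM; first exact: ideal_gen_ideal.
  apply: mem_ideal_gen; exists (fun=> 0); split; last by rewrite big_ord0.
  by case.
have /exists_inP[t tT at0] : [exists (t | t \notin [set i; j]), a t != 0%N].
  apply: contraTT ha => /exists_inPn h; rewrite -ltnNge /off big1 // => t /h.
  by move/negPn/eqP.
have Ua : (U_(t) <= a)%MM by rewrite lep1mP.
have offa := offD [set i; j] U_(t) (a - U_(t)).
rewrite addmC submK // off_U tT in offa.
rewrite -(submK Ua) addmC mpolyXD; apply: ideal_powS.
  apply: mem_ideal_gen; exists t; split=> //; apply: contraNneq tT => ->;
  by rewrite !inE eqxx ?orbT.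
by apply: IH; rewrite offa add1n ltnS in ha.
Qed.

Lemma symbolic_powerE (G : rel 'I_n) m f :
  symbolic_power k G m f <-> forall i j, G i j -> edge_ideal m i j f.
Proof. by split=> h i j /h/ideal_pow_edgeE. Qed.

(** P_ij^m is P_ij-primary; the hypothesis on [f] says that [f] is not in P_ij. *)
Lemma edge_ideal_reg m i j f u :
  (exists2 a, f@_a != 0 & off [set i; j] a = 0%N) ->
  edge_ideal m i j (f * u) -> edge_ideal m i j u.
Proof.
apply: mono_ideal_reg; [exact: off_upclosed|exact: offD|].
by move=> a b ea; rewrite offD ea.
Qed.

(** The two edges share [c]. Modulo P_ij^m + P_i'j'^m, the monomial ideal of [D], the product
    [f * (u - v)] is 0, and a term of [f] in x_c alone makes [f] regular there. *)
Lemma glue_adjacent m i j i' j' c f u v h :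
  c \in [set i; j] -> c \in [set i'; j'] ->
  (exists2 a, f@_a != 0 & off [set c] a = 0%N) ->
  edge_ideal m i j (f * u - h) -> edge_ideal m i' j' (f * v - h) ->
  forall a, (off [set i; j] a < m)%N -> (off [set i'; j'] a < m)%N -> u@_a = v@_a.
Proof.
move=> cT cT' fc hu hv a ha ha'.
pose D a := (m <= off [set i; j] a)%N || (m <= off [set i'; j'] a)%N.
have upD : upclosed D.
  by move=> b d /orP[h'|h']; apply/orP; [left|right]; apply: off_upclosed.
have fuv : mono_ideal D (f * (u - v)).
  rewrite (_ : _ * _ = (f * u - h) - (f * v - h)); last by ring.
  apply: (idealB (mono_ideal_ideal k upD)) => b hb; apply/orP.
    by left; apply: hu.
  by right; apply: hv.
have uv : mono_ideal D (u - v).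
  apply: (@mono_ideal_reg _ _ D (off [set c]) f) fuv => //; first exact: offD.
  have off0 i0 j0 b : c \in [set i0; j0] -> off [set c] b = 0%N -> off [set i0; j0] b = 0%N.
    by move=> cs eb; apply/eqP; rewrite -leqn0 -eb off_subset // sub1set.
  by move=> b d eb; rewrite /D !offD (off0 i j b) ?(off0 i' j' b).
apply/eqP; rewrite -subr_eq0 -mcoeffB; apply: contraTT ha => /uv.
by rewrite /D (leqNgt _ (off [set i'; j'] a)) ha' orbF -leqNgt.
Qed.

Definition four_cycles (G : rel 'I_n) : Prop := forall i j i' j',
  G i j -> G i' j' -> [disjoint [set i; j] & [set i'; j']] ->
  (G i i' /\ G j j') \/ (G i j' /\ G j i').

Section Glue.

Variables (G : rel 'I_n) (m : nat).
Hypotheses (symG : ssrbool.symmetric G) (irrG : irreflexive G) (cycG : four_cycles G).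

Lemma edge_neq i j : G i j -> i != j.
Proof. by apply: contraTneq => ->; rewrite irrG. Qed.

(** The coefficient of the glued polynomial at x^a is read off from any edge whose ideal misses x^a;
    the 4-cycles make all these edges agree. *)
Lemma glue_edges f h (z : 'I_n -> 'I_n -> {mpoly k[n]}) :
  (forall i, exists2 a, f@_a != 0 & off [set i] a = 0%N) ->
  (forall i j, G i j -> edge_ideal m i j (f * z i j - h)) ->
  exists y, forall i j, G i j -> edge_ideal m i j (y - z i j).
Proof.
move=> hf hz.
have adj i j i' j' a : G i j -> G i' j' ->
    (off [set i; j] a < m)%N -> (off [set i'; j'] a < m)%N ->
    ~~ [disjoint [set i; j] & [set i'; j']] -> (z i j)@_a = (z i' j')@_a.
  move=> gij gij' ha ha' /pred0Pn[c /andP[/= hc hc']].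
  exact: glue_adjacent hc hc' (hf c) (hz _ _ gij) (hz _ _ gij') a ha ha'.
(* The degrees off {i, j} and {i', j'} have the same sum as those off {i, i'} and {j, j'}. So one of
   the latter edges, which meet both given ones, also has degree below [m]. *)
have link i j i' j' a : G i j -> G i' j' -> G i i' -> G j j' ->
    (off [set i; j] a < m)%N -> (off [set i'; j'] a < m)%N ->
    (z i j)@_a = (z i' j')@_a.
  move=> gij gij' gii' gjj' ha ha'.
  have e1 := off_set2 a (edge_neq gij); have e2 := off_set2 a (edge_neq gij').
  have e3 := off_set2 a (edge_neq gii'); have e4 := off_set2 a (edge_neq gjj').
  have [h1|h1] := ltnP (off [set i; i'] a) m.
    rewrite (adj i j i i') // 1?(adj i i' i' j') //; apply/pred0Pn.
      by exists i'; rewrite /= !inE !eqxx ?orbT.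
    by exists i; rewrite /= !inE !eqxx ?orbT.
  have h2 : (off [set j; j'] a < m)%N by lia.
  rewrite (adj i j j j') // 1?(adj j j' i' j') //; apply/pred0Pn.
    by exists j'; rewrite /= !inE !eqxx ?orbT.
  by exists j; rewrite /= !inE !eqxx ?orbT.
have zsym i j a : G i j -> (off [set i; j] a < m)%N -> (z i j)@_a = (z j i)@_a.
  move=> gij ha; apply: adj => //; rewrite ?(symG j i) //; first by rewrite setUC.
  by apply/pred0Pn; exists i; rewrite /= !inE !eqxx ?orbT.
have compat i j i' j' a : G i j -> G i' j' ->
    (off [set i; j] a < m)%N -> (off [set i'; j'] a < m)%N ->
    (z i j)@_a = (z i' j')@_a.
  move=> gij gij' ha ha'.
  case: (boolP [disjoint [set i; j] & [set i'; j']]) => [dis|]; last exact: adj.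
  case: (cycG gij gij' dis) => [[g1 g2]|[g1 g2]]; first exact: link.
  rewrite (zsym i' j') //; apply: link => //; first by rewrite symG.
  by rewrite setUC.
pose c a := if [pick e : 'I_n * 'I_n | G e.1 e.2 && (off [set e.1; e.2] a < m)%N]
  is Some e then (z e.1 e.2)@_a else 0.
have cE i j a : G i j -> (off [set i; j] a < m)%N -> c a = (z i j)@_a.
  move=> gij ha; rewrite /c; case: pickP => [e /andP[ge he]|/(_ (i, j))].
    exact: compat.
  by rewrite /= gij ha.
pose N := (\max_i \max_j msize (z i j))%N.
have cN a : (N <= mdeg a)%N -> c a = 0.
  rewrite /c => ha; case: pickP => // e _; apply: memN_msupp_eq0.
  apply: msize_mdeg_ge; apply: leq_trans ha; rewrite /N.
  apply: leq_trans (leq_bigmax e.1).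
  exact: (leq_bigmax (F := fun j => msize (z e.1 j))).
pose y : {mpoly k[n]} := \sum_(b : 'X_{1..n < N}) c b *: 'X_[b].
have yE a : y@_a = c a.
  have [ha|ha] := ltnP (mdeg a) N; first exact: mcoeff_mpoly.
  rewrite (cN a ha) /y raddf_sum big1 //= => b _.
  rewrite mcoeffZ mcoeffX; case: eqP => [e|]; rewrite ?mulr0 //.
  by have := bmdeg b; rewrite e ltnNge ha.
exists y => i j gij a; rewrite mcoeffB yE; apply: contraNT; rewrite -ltnNge => ha.
by rewrite (cE i j) // subrr.
Qed.

End Glue.

End EdgeIdeals.

(** * Algebraic dependence of any three elements *)

Section AlgebraicDependence.

Lemma linear_dependence (k : fieldType) (T U : finType) (F : T -> U -> k) :
  (#|U| < #|T|)%N ->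
  exists v : T -> k, (exists t, v t != 0) /\ forall u, \sum_t v t * F t u = 0.
Proof.
move=> ltUT.
pose A : 'M[k]_(#|T|, #|U|) := \matrix_(i, j) F (enum_val i) (enum_val j).
have : kermx A != 0.
  rewrite -mxrank_eq0 mxrank_ker -lt0n subn_gt0.
  exact: leq_ltn_trans (rank_leq_col A) ltUT.
case/matrix0Pn=> i [j nz].
exists (fun t => kermx A i (enum_rank t)); split.
  by exists (enum_val j); rewrite enum_valK.
move=> u; have /matrixP/(_ i (enum_rank u)) := mulmx_ker A.
rewrite !mxE => e; rewrite -[RHS]e [RHS](reindex (@enum_rank T)) /=; last first.
  by apply: onW_bij; apply: enum_rank_bij.
by apply: eq_bigr => l _; rewrite [A _ _]mxE !enum_rankK.
Qed.

Lemma horner_map_poly_sum (A : nzRingType) (R : comNzRingType)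
    (ev : {rmorphism A -> R}) N (E : nat -> A) (s : R) :
  (map_poly ev (\poly_(i < N) E i)).[s] = \sum_(i < N) ev (E i) * s ^+ i.
Proof.
have -> : map_poly ev (\poly_(i < N) E i) = \poly_(i < N) ev (E i).
  apply/polyP => i; rewrite coef_map !coef_poly; case: ifP => // _.
  exact: rmorph0.
by rewrite horner_poly.
Qed.

Variables (k : fieldType) (n : nat).
Implicit Types (f g s : {mpoly k[n]}) (i j : 'I_n).

(** Evaluations of nested univariate polynomials, outer variable first, so that [lowest_coef] can
    strip one variable at a time. *)
Definition eval1 s : {rmorphism {poly k} -> {mpoly k[n]}} :=
  horner_morph (fun x => mulrC s (mpolyC n x)).

Definition eval2 s t : {rmorphism {poly {poly k}} -> {mpoly k[n]}} :=
  horner_morph (fun x => mulrC s (eval1 t x)).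

Definition eval3 s t u : {rmorphism {poly {poly {poly k}}} -> {mpoly k[n]}} :=
  horner_morph (fun x => mulrC s (eval2 t u x)).

Lemma eval1E s p : eval1 s p = (map_poly (@mpolyC n k) p).[s].
Proof. by []. Qed.

Lemma eval2E s t p : eval2 s t p = (map_poly (eval1 t) p).[s].
Proof. by []. Qed.

Lemma eval3E s t u p : eval3 s t u p = (map_poly (eval2 t u) p).[s].
Proof. by []. Qed.

Definition deg_le d f : Prop := forall a, f@_a != 0 -> (mdeg a <= d)%N.

Lemma deg_le_mul d e f g : deg_le d f -> deg_le e g -> deg_le (d + e) (f * g).
Proof.
by move=> hf hg a /mcoeff_mul_neq0[b [c [/hf hb /hg hc ->]]]; rewrite mdegD leq_add.
Qed.

Lemma deg_le_exp d e f : deg_le d f -> deg_le (e * d) (f ^+ e).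
Proof.
move=> hf; elim: e => [|e IH]; last by rewrite exprS mulSn; apply: deg_le_mul.
by move=> a; rewrite expr0 mcoeff1; case: (a =P 0%MM) => [->|_]; rewrite ?mdeg0 ?eqxx.
Qed.

Lemma deg_le_msize f : deg_le (msize f) f.
Proof. by move=> a; rewrite -mcoeff_msupp => /msize_mdeg_lt/ltnW. Qed.

(* Counting: among the N^3 monomials of degree < N in each of the three
   elements, restricted to the (3D+1)^2 N^2 monomials in x_i, x_j of the
   relevant degree, there is a linear relation. *)
Lemma alg_dependence_edge s1 s2 s3 i j : i != j ->
  exists2 Q : {poly {poly {poly k}}}, Q != 0 & edge_ideal 1 i j (eval3 s1 s2 s3 Q).
Proof.
move=> ij; pose D := (msize s1 + msize s2 + msize s3)%N.
have [d1 d2 d3] : [/\ deg_le D s1, deg_le D s2 & deg_le D s3].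
  by split=> a /deg_le_msize; rewrite /D; lia.
(* With these values W^2 = (N + 1)^2 N is less than the number (N + 1)^3 of exponent triples, while
   products of powers up to [N] have degree at most 3 N D, which is below [W]. *)
pose N := ((3 * D + 1) ^ 2)%N; pose W := (N.+1 * (3 * D + 1))%N.
pose F (t : 'I_N.+1 * 'I_N.+1 * 'I_N.+1) (u : 'I_W * 'I_W) : k :=
  (s3 ^+ t.2 * s2 ^+ t.1.2 * s1 ^+ t.1.1)@_(U_(i) *+ u.1 + U_(j) *+ u.2)%MM.
have [|v [[t0 nzt0] hv]] := @linear_dependence _ _ _ F.
  rewrite !card_prod !card_ord /W (_ : _ * _ = N.+1 * N.+1 * N)%N; last by rewrite /N; ring.
  by rewrite ltn_pmul2l // muln_gt0.
pose V (a b c : nat) := v (inord a, inord b, inord c).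
exists (\poly_(a < N.+1) \poly_(b < N.+1) \poly_(c < N.+1) V a b c).
  apply: contraNneq nzt0 => Q0; case: t0 => [[a b] c].
  have : (\poly_(a < N.+1) \poly_(b < N.+1) \poly_(c < N.+1) V a b c)`_a`_b`_c = 0.
    by rewrite Q0 !coef0.
  by do 3!rewrite coef_poly ltn_ord; rewrite /V !inord_val => ->.
have evE : eval3 s1 s2 s3
      (\poly_(a < N.+1) \poly_(b < N.+1) \poly_(c < N.+1) V a b c) =
    \sum_(t : 'I_N.+1 * 'I_N.+1 * 'I_N.+1)
      v t *: (s3 ^+ t.2 * s2 ^+ t.1.2 * s1 ^+ t.1.1).
  transitivity (\sum_(a < N.+1) \sum_(b < N.+1) \sum_(c < N.+1)
    v (a, b, c) *: (s3 ^+ c * s2 ^+ b * s1 ^+ a)); last first.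
    by rewrite pair_bigA /= pair_bigA /=; apply: eq_bigr => -[[a b] c].
  rewrite eval3E horner_map_poly_sum.
  apply: eq_bigr => a _; rewrite eval2E horner_map_poly_sum mulr_suml.
  apply: eq_bigr => b _; rewrite eval1E horner_map_poly_sum !mulr_suml.
  apply: eq_bigr => c _; rewrite /V !inord_val.
  by rewrite mul_mpolyC !scalerAl.
rewrite evE => a; apply: contraNT; rewrite -ltnNge ltnS leqn0 => /eqP offa.
have aE : a = (U_(i) *+ a i + U_(j) *+ a j)%MM.
  apply/mnmP => t; rewrite mnmDE !mulmnE !mnm1E.
  have [<-|it] := eqVneq i t; first by rewrite eq_sym (negbTE ij) mul1n addn0.
  have [<-|jt] := eqVneq j t; first by rewrite mul1n.
  have /eqP := offa; rewrite /off sum_nat_eq0 => /forallP/(_ t).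
  by rewrite !inE ![t == _]eq_sym (negbTE it) (negbTE jt) => /eqP.
rewrite raddf_sum /=; apply/eqP.
have ha := off_set2 a ij; rewrite offa add0n in ha.
have [aW|Wa] := ltnP (mdeg a) W.
  have [hai haj] : (a i < W)%N /\ (a j < W)%N by rewrite -ha in aW; lia.
  have := hv (Ordinal hai, Ordinal haj); rewrite /F /= -aE => e; rewrite -[RHS]e.
  by apply: eq_bigr => t _; rewrite mcoeffZ.
rewrite big1 // => -[[b c] d] _ /=; rewrite mcoeffZ; apply/eqP.
rewrite mulf_eq0; apply/orP; right; apply: contraTT Wa => nz; rewrite -ltnNge.
have h3 := deg_le_exp (e := d) d3; have h2 := deg_le_exp (e := c) d2.
have := deg_le_mul (deg_le_mul h3 h2) (deg_le_exp (e := b) d1) nz.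
move/leq_ltn_trans; apply; rewrite -!mulnDl /W.
have [hb hc hd] := And3 (ltn_ord b) (ltn_ord c) (ltn_ord d).
apply: (@leq_ltn_trans (N * 3 * D)%N); first by rewrite leq_mul2r; apply/orP; right; lia.
rewrite mulSn mulnDr muln1 mulnA; lia.
Qed.

Lemma alg_dependence (G : rel 'I_n) m s1 s2 s3 : irreflexive G ->
  exists2 Q : {poly {poly {poly k}}}, Q != 0 &
    forall i j, G i j -> edge_ideal m i j (eval3 s1 s2 s3 Q).
Proof.
move=> irrG.
have [Q hQ] : exists Q : 'I_n * 'I_n -> {poly {poly {poly k}}}, forall e,
    Q e != 0 /\ (G e.1 e.2 -> edge_ideal 1 e.1 e.2 (eval3 s1 s2 s3 (Q e))).
  apply: (@fin_all_exists _ (fun=> {poly {poly {poly k}}}) (fun e Q => Q != 0 /\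
    (G e.1 e.2 -> edge_ideal 1 e.1 e.2 (eval3 s1 s2 s3 Q)))) => -[i j] /=.
  case: (boolP (G i j)) => [gij|_].
    have ij : i != j by apply: contraTneq gij => ->; rewrite irrG.
    by have [Q Q0 hQ] := alg_dependence_edge s1 s2 s3 ij; exists Q.
  by exists 1; rewrite oner_neq0.
(* The factor [Q e] evaluates into P_e, so its m-th power puts the product in P_e^m for every edge
   e. *)
exists (\prod_e Q e ^+ m).
  by apply/prodf_neq0 => e _; rewrite expf_neq0 //; case: (hQ e).
move=> i j gij; rewrite rmorph_prod (bigD1 (i, j)) //=.
apply: (idealMl _ (edge_ideal_ideal k m i j)); rewrite rmorphXn.
by apply: edge_ideal_exp; case: (hQ (i, j)) => _; apply.
Qed.

(** Three uses of [lowest_coef] strip the variables of [Q] and leave a nonzero constant in [K3].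
    This bounds both chains of primes and regular sequences. *)
Lemma no_regular_triple (K0 K1 K2 K3 : {mpoly k[n]} -> Prop) s1 s2 s3 Q :
  is_ideal K0 -> is_ideal K1 -> is_ideal K2 -> is_ideal K3 ->
  (forall x, K0 x -> K1 x) -> (forall x, K1 x -> K2 x) -> (forall x, K2 x -> K3 x) ->
  K1 s1 -> K2 s2 -> K3 s3 ->
  (forall u, K0 (s1 * u) -> K0 u) -> (forall u, K1 (s2 * u) -> K1 u) ->
  (forall u, K2 (s3 * u) -> K2 u) ->
  Q != 0 -> K0 (eval3 s1 s2 s3 Q) -> K3 1.
Proof.
move=> i0 i1 i2 i3 k01 k12 k23 h1 h2 h3 r1 r2 r3 nz hQ.
have [Q1 nz1 hQ1] := lowest_coef i0 i1 k01 h1 r1 nz hQ.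
have [Q2 nz2 hQ2] := lowest_coef i1 i2 k12 h2 r2 nz1 hQ1.
have [c c0 hc] := lowest_coef i2 i3 k23 h3 r3 nz2 hQ2.
rewrite -(mpolyC1 n k) -(mulVf c0) mpolyCM; exact: idealM.
Qed.

End AlgebraicDependence.

(** * A Nullstellensatz in two variables *)

Section PlaneNullstellensatz.

Variable k : fieldType.

Lemma dvdp_is_ideal (u : {poly k}) : is_ideal (fun x => u %| x).
Proof.
split=> [|x y|a x]; [exact: dvdp0|exact: dvdp_add|exact: dvdp_mull].
Qed.

(* If [N] met [k[x]] trivially, an element [f] of [N] of least degree in [y],
   with leading coefficient [c], would divide the elements of [N] up to powers
   of [c]. But [u = 1 + x c] is invertible modulo [N], and [u] is prime to [c]. *)
Lemma plane_nullstellensatz (N : {poly {poly k}} -> Prop) :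
  is_ideal N -> ~ N 1 -> (forall u, ~ N u -> exists h, N (u * h - 1)) ->
  exists2 p : {poly k}, p != 0 & N p%:P.
Proof.
move=> hN N1 inv; apply: NNPP => hn.
have N0 p : N p%:P -> p = 0.
  by move=> Np; apply: NNPP => p0; apply: hn; exists p => //; apply/eqP.
have [f0 [Nf0 nz0]] : exists f, N f /\ f != 0.
  have [NX|/inv[h Nh]] := classic (N 'X); first by exists 'X; rewrite polyX_eq0.
  exists ('X * h - 1); split=> //; apply/eqP => /(congr1 (fun p : {poly {poly k}} => p`_0)).
  rewrite coefB coefXM coef0 coef1 sub0r /= => /eqP.
  by rewrite oppr_eq0 oner_eq0.
have [f [Nf nzf minf]] : exists f, [/\ N f, f != 0 &
    forall g, N g -> (size g < size f)%N -> g = 0].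
  have [s] := ubnP (size f0); elim: s => // s IH in f0 Nf0 nz0 *; rewrite ltnS => hs.
  have [[g [Ng nzg hg]]|nog] :=
      classic (exists g, [/\ N g, g != 0 & (size g < size f0)%N]).
    by apply: (IH g) => //; apply: leq_trans hs.
  exists f0; split=> // g Ng hg; apply: NNPP => /eqP nzg.
  by apply: nog; exists g.
set c := lead_coef f.
have nzc : c != 0 by rewrite lead_coef_eq0.
pose d := (size f).-1.
(* A constant [f] would be a nonzero element of [N] coming from k[x]. *)
have d_gt0 : (0 < d)%N.
  rewrite /d; case: (ltnP 1 (size f)) => [|/size1_polyC fE]; first by case: (size f).
  by move: nzf; rewrite fE (N0 f`_0) ?polyC0 ?eqxx // -fE.
pose u := 1 + 'X * c.
have size_u : (1 < size u)%N.
  by rewrite /u addrC size_polyDl mulrC size_mulX // ?size_poly1 ltnS size_poly_gt0.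
have nzu : u != 0 by rewrite -size_poly_gt0; apply: ltnW.
have [h Ng] : exists h, N (u%:P * h - 1).
  by apply: inv => /N0/eqP; rewrite (negbTE nzu).
set g := _ - 1 in Ng.
(* The remainder of the pseudo-division of [g] by [f] lies in [N] and has smaller degree than [f],
   so it vanishes. *)
have divg : c ^+ scalp g f *: g = g %/ f * f.
  rewrite Pdiv.Idomain.divp_eq -[RHS]addr0; congr (_ + _). apply: minf; last by rewrite ltn_modp.
  have -> : g %% f = (c ^+ scalp g f)%:P * g - g %/ f * f.
    by rewrite mul_polyC Pdiv.Idomain.divp_eq addrC addKr.
  by apply: idealB => //; apply: idealM.
(* The top coefficient u - x c of [F] is 1, and [F] is congruent to - x f modulo [u]: a monic
   substitute for [f]. *)
pose F := u *: 'X^d - 'X *: f.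
have szF : size F = d.+1.
  apply/eqP; rewrite eqn_leq; apply/andP; split.
    apply/leq_sizeP => j hj; rewrite coefB !coefZ coefXn gtn_eqF // mulr0 sub0r.
    by rewrite (nth_default _ (s := f)) ?mulr0 ?oppr0 // (leq_trans _ hj) // leqSpred.
  rewrite ltnNge; apply/negP => /leq_sizeP/(_ d (leqnn d)) /eqP.
  rewrite coefB !coefZ coefXn eqxx mulr1 -/(lead_coef f) -/c /u addrK.
  by rewrite oner_eq0.
have monF : F \is monic.
  apply/monicP; rewrite /lead_coef szF coefB !coefZ coefXn eqxx mulr1.
  by rewrite -/(lead_coef f) -/c /u addrK.
(* In positive degree the coefficients of [g] are multiples of [u]; hence so are those of
   [F * (g %/ f)] from degree [d] on and, [F] being monic, all those of [g %/ f]. *)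
have divq : forall l, u %| (g %/ f)`_l.
  apply: (monic_mul_coef (dvdp_is_ideal u) monF) => l; rewrite szF /= => hl.
  rewrite mulrBl coefB; apply: dvdp_sub.
    by rewrite -scalerAl coefZ dvdp_mulr.
  rewrite -scalerAl coefZ [f * _]mulrC -divg coefZ; do 2!apply: dvdp_mull.
  rewrite /g coefB coefCM coef1 (_ : (l == 0%N) = false) ?subr0 ?dvdp_mulr //.
  by apply: gtn_eqF; apply: leq_trans hl.
have copuc : coprimep u c.
  apply/Bezout_coprimepP; exists (1, - 'X); rewrite /= mul1r mulNr /u addrK.
  exact: eqpxx.
(* The constant coefficient now makes [u] divide a power of [c], although [u] is prime to [c] and
   not constant. *)
have : u %| c ^+ scalp g f * (u * h`_0 - 1).
  have -> : c ^+ scalp g f * (u * h`_0 - 1) = (g %/ f * f)`_0.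
    by rewrite -divg coefZ coefB coefCM coef1 eqxx.
  by rewrite coefM; apply: (ideal_sum (dvdp_is_ideal u)) => l _; apply: dvdp_mulr.
rewrite mulrBr mulrCA mulr1 dvdp_subr ?dvdp_mulr // => udvd.
have : u %| c ^+ scalp g f * 1 by rewrite mulr1.
rewrite Gauss_dvdpr ?coprimep_expr // dvdp1 => /eqP su.
by rewrite su in size_u.
Qed.

End PlaneNullstellensatz.

(** * Morphisms from polynomial rings, and the Nullstellensatz on an edge *)

Section MpolyMorphisms.

Variables (k : fieldType) (n : nat).
Implicit Types (f g h : {mpoly k[n]}) (i j t : 'I_n).

Lemma mpoly_ring_ind (P : {mpoly k[n]} -> Prop) :
  (forall c, P c%:MP) -> (forall t, P 'X_t) ->
  (forall f g, P f -> P g -> P (f + g)) -> (forall f g, P f -> P g -> P (f * g)) ->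
  forall f, P f.
Proof.
move=> hC hX hD hM f; rewrite (mpolyE f).
apply: (big_ind P) => [|//|a _]; first by rewrite -(mpolyC0 n k).
rewrite -mul_mpolyC; apply: (hM) => //; rewrite mpolyXE_id.
apply: (big_ind P) => [|//|t _]; first by rewrite -(mpolyC1 n k).
elim: (a t) => [|e IH]; first by rewrite expr0 -(mpolyC1 n k).
by rewrite exprS; apply: hM.
Qed.

Lemma rmorph_mpoly_congr (R : comNzRingType) (K : R -> Prop)
    (al be : {rmorphism {mpoly k[n]} -> R}) : is_ideal K ->
  (forall c, K (al c%:MP - be c%:MP)) -> (forall t, K (al 'X_t - be 'X_t)) ->
  forall f, K (al f - be f).
Proof.
move=> hK hC hX; apply: mpoly_ring_ind => // f g hf hg.
  by rewrite !rmorphD /= opprD addrACA; apply: idealD.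
rewrite !rmorphM /= (_ : _ - _ = al f * (al g - be g) + be g * (al f - be f)).
  by apply: idealD => //; apply: idealM.
by ring.
Qed.

Lemma eval1C (s : {mpoly k[n]}) c : eval1 s c%:P = c%:MP.
Proof. by rewrite eval1E map_polyC hornerC. Qed.

Lemma eval1X (s : {mpoly k[n]}) : eval1 s 'X = s.
Proof. by rewrite eval1E map_polyX hornerX. Qed.

Lemma eval2C (s t : {mpoly k[n]}) c : eval2 s t c%:P = eval1 t c.
Proof. by rewrite eval2E map_polyC hornerC. Qed.

Lemma eval2X (s t : {mpoly k[n]}) : eval2 s t 'X = s.
Proof. by rewrite eval2E map_polyX hornerX. Qed.

Lemma mcoeff_eval1 i (p : {poly k}) e : (eval1 'X_i p)@_(U_(i) *+ e)%MM = p`_e.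
Proof.
have UE (d : nat) : ('X_i : {mpoly k[n]}) ^+ d = 'X_[U_(i) *+ d] by rewrite mpolyXn.
have inj (d : nat) : ((U_(i) *+ d)%MM == (U_(i) *+ e)%MM :> 'X_{1..n}) = (d == e).
  apply/eqP/eqP => [/(congr1 (fun a : 'X_{1..n} => a i))|->//].
  by rewrite !mulmnE mnm1E eqxx !mul1n.
rewrite -{1}[p]coefK eval1E horner_map_poly_sum raddf_sum /=.
have [he|he] := ltnP e (size p).
  rewrite (bigD1 (Ordinal he)) //= mcoeffCM UE mcoeffX inj eqxx mulr1.
  rewrite big1 ?addr0 // => l le; rewrite mcoeffCM UE mcoeffX inj.
  by rewrite (_ : (l == e :> nat) = false) ?mulr0 //; apply: negbTE.
rewrite nth_default // big1 // => l _; rewrite mcoeffCM UE mcoeffX inj.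
by rewrite ltn_eqF ?mulr0 // (leq_trans (ltn_ord l)).
Qed.

(** [N] contains P_ij, so it is determined in the plane k[x_i, x_j]: [phi] sends the other variables
    to 0, [psi] undoes it modulo [N], and the plane case applies to the preimage of [N] under
    [psi]. *)
Lemma edge_nullstellensatz (N : {mpoly k[n]} -> Prop) i j : i != j ->
  is_ideal N -> ~ N 1 -> (forall u, ~ N u -> exists h, N (u * h - 1)) ->
  (forall f, edge_ideal 1 i j f -> N f) ->
  exists2 p : {poly k}, p != 0 & N (eval1 'X_i p).
Proof.
move=> ij hN N1 inv sub.
pose psi := eval2 ('X_j : {mpoly k[n]}) 'X_i.
pose gens t : {poly {poly k}} := if t == i then 'X%:P else if t == j then 'X else 0.
pose phi : {rmorphism {mpoly k[n]} -> {poly {poly k}}} :=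
  mmap (@polyC _ \o @polyC k) gens.
have psiK h : N (psi (phi h) - h).
  apply: (@rmorph_mpoly_congr _ N (psi \o phi) idfun) => [//|c|t] /=.
    by rewrite mmapC /= eval2C eval1C subrr; case: hN.
  rewrite mmapX mmap1U /gens; have [->|ti] := eqVneq t i.
    by rewrite eval2C eval1X subrr; case: hN.
  have [->|tj] := eqVneq t j; first by rewrite eval2X subrr; case: hN.
  by rewrite rmorph0 sub0r; apply: idealN => //; apply: sub; apply: edge_idealU.
have [|||p nzp hp] := @plane_nullstellensatz k (fun u => N (psi u)).
- split=> [|x y|a x]; rewrite ?rmorph0 ?rmorphD ?rmorphM; first by case: hN.
    exact: idealD.
  exact: idealM.
- by rewrite rmorph1.
- move=> u /inv[h Nh]; exists (phi h); rewrite rmorphB rmorphM rmorph1 /=.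
  rewrite (_ : _ - _ = psi u * (psi (phi h) - h) + (psi u * h - 1)); last by ring.
  by apply: idealD => //; apply: idealM.
by exists p => //; rewrite -(eval2C 'X_j).
Qed.

(** The product of polynomials found for the single variables serves all of them. The extra factor
    ['X] removes the constant term, which puts p(x_t) in every ideal containing x_t. *)
Lemma common_monic (N : {mpoly k[n]} -> Prop) i j : i != j ->
  is_ideal N -> ~ N 1 -> (forall u, ~ N u -> exists h, N (u * h - 1)) ->
  (forall f, edge_ideal 1 i j f -> N f) ->
  exists p : {poly k}, [/\ p \is monic, p`_0 = 0 & forall t, N (eval1 'X_t p)].
Proof.
move=> ij hN N1 inv sub.
have [p hp] : exists p : 'I_n -> {poly k}, forall t, p t != 0 /\ N (eval1 'X_t (p t)).
  apply: (@fin_all_exists _ (fun=> {poly k}) (fun t p => p != 0 /\ N (eval1 'X_t p))) => t.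
  have [->|ti] := eqVneq t i.
    by have [p] := edge_nullstellensatz ij hN N1 inv sub; exists p.
  have [->|tj] := eqVneq t j.
    have ji : j != i by rewrite eq_sym.
    have [|p] := edge_nullstellensatz ji hN N1 inv; last by exists p.
    by move=> f hf; apply: sub; apply: edge_idealC.
  by exists 'X; rewrite polyX_eq0 eval1X; split=> //; apply: sub; apply: edge_idealU.
pose q := \prod_t p t; have nzq : q != 0.
  by apply/prodf_neq0 => t _; case: (hp t).
exists ('X * ((lead_coef q)^-1 *: q)); split.
- by rewrite monicMl ?monicX //; apply/monicP; rewrite lead_coefZ mulVf // lead_coef_eq0.
- by rewrite coefXM.
- move=> t; rewrite rmorphM; apply: idealM => //; rewrite -mul_polyC rmorphM.
  apply: idealM => //; rewrite rmorph_prod (bigD1 t) //=; apply: idealMl => //.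
  by case: (hp t).
Qed.

End MpolyMorphisms.

(** * Reading a polynomial in one of its variables *)

Section Coefficients.

Variables (k : fieldType) (n : nat).
Implicit Types (f g h : {mpoly k[n]}) (i j t : 'I_n).

Definition coefs_in (R : comNzRingType) (K : R -> Prop) (P : {poly R}) : Prop :=
  forall l, K P`_l.

Lemma coefs_in_ideal (R : comNzRingType) (K : R -> Prop) :
  is_ideal K -> is_ideal (coefs_in K).
Proof.
move=> hK; split=> [l|x y hx hy l|a x hx l].
- by rewrite coef0; case: hK.
- by rewrite coefD; apply: idealD.
- by rewrite coefM; apply: ideal_sum => // s _; apply: idealM.
Qed.

(* Rereads a polynomial as one in x_j; the coefficients stay in the same ring.
   Sealed, because unfolding [mmap] makes failing conversion tests very slow. *)
Fact expand_subproof j :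
  {phi : {rmorphism {mpoly k[n]} -> {poly {mpoly k[n]}}} |
    [/\ forall c, phi c%:MP = (c%:MP)%:P, phi 'X_j = 'X &
        forall t, t != j -> phi 'X_t = ('X_t)%:P]}.
Proof.
exists (mmap (@polyC _ \o @mpolyC n k) (fun t => if t == j then 'X else ('X_t)%:P)).
split=> [c||t tj] /=; first by rewrite mmapC.
  by rewrite mmapX mmap1U eqxx.
by rewrite mmapX mmap1U (negbTE tj).
Qed.

Definition expand j : {rmorphism {mpoly k[n]} -> {poly {mpoly k[n]}}} :=
  sval (expand_subproof j).

Lemma expandC j c : expand j c%:MP = (c%:MP)%:P.
Proof. by case: (svalP (expand_subproof j)). Qed.

Lemma expandX j : expand j 'X_j = 'X.
Proof. by case: (svalP (expand_subproof j)). Qed.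

Lemma expandXN j t : t != j -> expand j 'X_t = ('X_t)%:P.
Proof. by case: (svalP (expand_subproof j)) => _ _; apply. Qed.

Lemma horner_expand j f : (expand j f).['X_j] = f.
Proof.
elim/mpoly_ring_ind: f => [c|t|f g hf hg|f g hf hg].
- by rewrite expandC hornerC.
- have [->|tj] := eqVneq t j; first by rewrite expandX hornerX.
  by rewrite expandXN // hornerC.
- by rewrite rmorphD /= hornerD hf hg.
- by rewrite rmorphM /= hornerM hf hg.
Qed.

Lemma expand_eval1N j t p : t != j -> expand j (eval1 'X_t p) = (eval1 'X_t p)%:P.
Proof.
move=> tj; elim/poly_ind: p => [|p c IH]; first by rewrite !rmorph0.
by rewrite !rmorphD !rmorphM /= !eval1C !eval1X expandC expandXN // IH.
Qed.

Lemma expand_eval1 j p : expand j (eval1 'X_j p) = map_poly (@mpolyC n k) p.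
Proof.
elim/poly_ind: p => [|p c IH]; first by rewrite !rmorph0.
rewrite !rmorphD !rmorphM /= eval1C eval1X expandC expandX IH.
by rewrite map_polyX map_polyC.
Qed.

Lemma coefs_in_edgeM m m' i j (P Q : {poly {mpoly k[n]}}) :
  coefs_in (edge_ideal m i j) P -> coefs_in (edge_ideal m' i j) Q ->
  coefs_in (edge_ideal (m + m') i j) (P * Q).
Proof.
move=> hP hQ l; rewrite coefM; apply: (ideal_sum (edge_ideal_ideal k (m + m') i j)) => s _.
exact: edge_ideal_mul.
Qed.

(** It is enough to treat generators: a generator x_t of P_ij has t different from j, so it stays a
    constant coefficient. *)
Lemma expand_edge m i j f :
  edge_ideal m i j f -> coefs_in (edge_ideal m i j) (expand j f).
Proof.
have idl m' := coefs_in_ideal (edge_ideal_ideal k m' i j).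
have pull m' : is_ideal (fun f => coefs_in (edge_ideal m' i j) (expand j f)).
  split=> [|x y hx hy|a x hx]; rewrite ?rmorph0 ?rmorphD ?rmorphM.
  - by case: (idl m').
  - exact: (idealD (idl m')).
  - exact: (idealM _ (idl m')).
move/ideal_pow_edgeE; apply: (ideal_gen_min (pull m)) => _ [a [ha ->]].
elim: m a ha => [|m IH] a ha; first by move=> l; apply: edge_ideal0.
have h0 : coefs_in (edge_ideal 1 i j) (expand j (a ord0)).
  apply: (ideal_gen_min (pull 1%N)) (ha ord0) => _ [t [ti tj ->]] l.
  rewrite expandXN // coefC; case: ifP => _; first exact: edge_idealU.
  by case: (edge_ideal_ideal k 1 i j).
have hS : coefs_in (edge_ideal m i j) (expand j (\prod_(l < m) a (lift ord0 l))).
  by apply: IH => l; apply: ha.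
by rewrite big_ord_recl rmorphM; apply: (@coefs_in_edgeM 1 m i j _ _ h0 hS).
Qed.

End Coefficients.

(** * Regularity of e_1(y), e_2(y) on one edge *)

Section RegularPair.

Variables (k : fieldType) (n : nat) (p : {poly k}).
Hypotheses (monp : p \is monic) (p0 : p`_0 = 0).
Implicit Types (f g h : {mpoly k[n]}) (i j s t : 'I_n).

Definition subst_var t : {mpoly k[n]} := eval1 'X_t p.

Definition sym1 : {mpoly k[n]} := \sum_t subst_var t.

Definition sym2 : {mpoly k[n]} :=
  \sum_(s < n) \sum_(t < n) (if (s < t)%N then subst_var s * subst_var t else 0).

(** [rest1 j] and [rest2 j] are e_1 and e_2 of the y_t with t different from j. *)
Let rest1 j := \sum_(t | t != j) subst_var t.

Let rest2 j := \sum_(s < n | s != j) \sum_(t < n | t != j)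
  (if (s < t)%N then subst_var s * subst_var t else 0).

Lemma sym1E j : sym1 = subst_var j + rest1 j.
Proof. by rewrite /sym1 (bigD1 j). Qed.

Lemma sym2E j : sym2 = subst_var j * rest1 j + rest2 j.
Proof.
rewrite /sym2 (bigD1 j) //= (bigD1 (P := xpredT) j) //= ltnn add0r.
under [X in _ + X]eq_bigr => s sj do rewrite (bigD1 (P := xpredT) j) //=.
rewrite [X in _ + X]big_split /= addrA; congr (_ + _).
rewrite -big_split /= mulr_sumr; apply: eq_bigr => t tj.
case: (ltngtP j t) => [jt|tj'|e]; rewrite ?addr0 ?add0r // 1?mulrC //.
by move: tj; rewrite -(inj_eq val_inj) /= e eqxx.
Qed.

Lemma subst_var_edge i j t : t != i -> t != j -> edge_ideal 1 i j (subst_var t).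
Proof.
move=> ti tj; rewrite /subst_var.
have -> : p = \poly_(l < (size p).-1) p`_l.+1 * 'X.
  apply/polyP => l; rewrite coefMX; case: l => [|l] /=; first exact: p0.
  rewrite coef_poly; case: ifP => // /negbT; rewrite -leqNgt => h.
  by rewrite nth_default //; lia.
rewrite rmorphM eval1X; apply: (idealM _ (edge_ideal_ideal k 1 i j)).
exact: edge_idealU.
Qed.

(** As p^e is monic, y_i^e has a term in x_i alone. *)
Lemma subst_var_exp_notin i j e : ~ edge_ideal 1 i j (subst_var i ^+ e).
Proof.
have mon : p ^+ e \is monic by apply: monic_exp.
rewrite -rmorphXn => /(_ (U_(i) *+ (size (p ^+ e)).-1)%MM).
rewrite mcoeff_eval1 -/(lead_coef (p ^+ e)) (monicP mon) oner_eq0 => /(_ isT).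
rewrite lt0n => /eqP; apply; rewrite /off big1 // => t.
by rewrite !inE negb_or mulmnE mnm1E eq_sym => /andP[/negbTE->].
Qed.

Lemma edge_ideal1PN i j f :
  ~ edge_ideal 1 i j f -> exists2 a, f@_a != 0 & off [set i; j] a = 0%N.
Proof.
move=> h; apply: NNPP => hn; apply: h => a fa; rewrite lt0n; apply/eqP => e.
by apply: hn; exists a.
Qed.

(** On the axis of x_i all other y_t vanish, and y_i does not. *)
Lemma sym1_axis i : exists2 a, sym1@_a != 0 & off [set i] a = 0%N.
Proof.
have hid := edge_ideal_ideal k 1 i i.
suff /edge_ideal1PN : ~ edge_ideal 1 i i sym1 by rewrite setUid.
rewrite (sym1E i) => h; apply: (@subst_var_exp_notin i i 1).
rewrite expr1 -(addrK (rest1 i) (subst_var i)); apply: (idealB hid) => //.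
rewrite /rest1 big_mkcond; apply: (ideal_sum hid) => t _.
by case: ifP => ti; [apply: subst_var_edge|case: hid].
Qed.

(** Modulo P_ij, [rest1 j] is y_i and [rest2 j] is 0, so the element is y_i^2 there. *)
Lemma rest_edge i j : i != j ->
  exists2 a, (rest1 j ^+ 2 - rest2 j)@_a != 0 & off [set i; j] a = 0%N.
Proof.
move=> ij; have hid := edge_ideal_ideal k 1 i j.
apply: edge_ideal1PN => h; apply: (@subst_var_exp_notin i j 2).
pose r := \sum_(t | (t != j) && (t != i)) subst_var t.
have r1 : rest1 j = subst_var i + r by rewrite /rest1 (bigD1 i).
have hr : edge_ideal 1 i j r.
  rewrite /r big_mkcond; apply: (ideal_sum hid) => t _.
  by case: ifP => [/andP[tj ti]|_]; [apply: subst_var_edge|case: hid].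
have hr2 : edge_ideal 1 i j (rest2 j).
  rewrite /rest2 big_mkcond; apply: (ideal_sum hid) => s _.
  case: ifP => sj; last by case: hid.
  rewrite big_mkcond; apply: (ideal_sum hid) => t _.
  case: ifP => tj; last by case: hid.
  case: ifP => st; last by case: hid.
  have [si|si] := eqVneq s i; last by apply: (idealMl _ hid); apply: subst_var_edge.
  apply: (idealM _ hid); apply: subst_var_edge => //.
  by apply: contraTneq st => ->; rewrite si ltnn.
rewrite (_ : _ ^+ 2 = (rest1 j ^+ 2 - rest2 j) + rest2 j - (subst_var i *+ 2 + r) * r).
  by apply: (idealB hid); [apply: (idealD hid)|apply: (idealM _ hid)].
by rewrite r1; ring.
Qed.

(* Modulo [sym1], [sym2] is minus [gam = rest1^2 - rest2], which is free of
   [x_j], whereas [sym1] is monic in [x_j]; so [sym1] is regular modulo [gam]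
   and the edge ideal. *)
Lemma sym_edge_regular m i j h v : i != j ->
  edge_ideal m i j (sym2 * h - sym1 * v) ->
  exists z, edge_ideal m i j (sym1 * z - h).
Proof.
move=> ij hE; have hid := edge_ideal_ideal k m i j.
pose gam := rest1 j ^+ 2 - rest2 j.
pose K x := exists a, edge_ideal m i j (x - gam * a).
have hK : is_ideal K.
  split.
  - by exists 0; rewrite mulr0 subr0; case: hid.
  - move=> x y [a ha] [b hb]; exists (a + b).
    by rewrite (_ : _ - _ = (x - gam * a) + (y - gam * b)); [apply: (idealD hid)|ring].
  - move=> c x [a ha]; exists (c * a).
    by rewrite (_ : _ - _ = c * (x - gam * a)); [apply: (idealM _ hid)|ring].
(* Since [sym2] is [sym1 * rest1 j - gam], the hypothesis becomes [sym1 * w = gam * h] modulo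
   P_ij^m. *)
pose w := rest1 j * h - v.
have hw : edge_ideal m i j (sym1 * w - gam * h).
  by move: hE; rewrite (sym2E j) (sym1E j) /w /gam; congr edge_ideal; ring.
have rest1C : expand k j (rest1 j) = (rest1 j)%:P.
  by rewrite /rest1 !rmorph_sum; apply: eq_bigr => t tj; apply: expand_eval1N.
have rest2C : expand k j (rest2 j) = (rest2 j)%:P.
  rewrite /rest2 rmorph_sum [RHS]rmorph_sum; apply: eq_bigr => s sj.
  rewrite rmorph_sum [RHS]rmorph_sum; apply: eq_bigr => t tj.
  case: ifP => _; last by rewrite !rmorph0.
  by rewrite !rmorphM /= !expand_eval1N.
have gamC : expand k j gam = gam%:P.
  by rewrite /gam !rmorphB !rmorphXn /= rest1C rest2C.
have szp : (1 < size p)%N.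
  rewrite ltnNge; apply/negP => /size1_polyC e; have := monicP monp.
  by rewrite e p0 lead_coefC => /eqP; rewrite eq_sym oner_eq0.
have mon1 : expand k j sym1 \is monic.
  rewrite (sym1E j) rmorphD /= rest1C expand_eval1; apply/monicP.
  have mon : map_poly (@mpolyC n k) p \is monic by apply: monic_map.
  rewrite lead_coefDl ?(monicP mon) // size_polyC.
  rewrite size_map_poly_id0 ?(monicP monp) ?rmorph1 ?oner_eq0 //.
  by case: (_ != 0); rewrite // ltnW.
(* In x_j, [sym1] is monic and [gam] is constant, so [monic_mul_coef] applies to [K], which is
   P_ij^m + (gam). *)
have hcoef : forall l, K (expand k j w)`_l.
  apply: (monic_mul_coef hK mon1) => l _.
  have : edge_ideal m i j (expand k j (sym1 * w - gam * h))`_l.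
    exact: (@expand_edge _ _ _ _ _ _ hw).
  rewrite rmorphB !rmorphM /= gamC coefB coefCM => hl.
  by exists (expand k j h)`_l.
have [z hz] : K w.
  rewrite -(horner_expand j w) horner_coef; apply: ideal_sum => // l _.
  by apply: idealMl.
(* Now w = gam z modulo P_ij^m, and [gam], not being in P_ij, cancels from gam (sym1 z - h). *)
exists z; apply: (edge_ideal_reg (f := gam)); first exact: rest_edge.
rewrite (_ : _ * _ = (sym1 * w - gam * h) - sym1 * (w - gam * z)); last by ring.
by apply: (idealB hid) => //; apply: (idealM _ hid).
Qed.

End RegularPair.

(** * Gauss's lemma for prime ideals *)

Section CoefsPrime.

Variables (R : comNzRingType) (K : R -> Prop).
Hypotheses (idK : is_ideal K) (primeK : forall x y, K (x * y) -> K x \/ K y).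

(** The product of the lowest coefficients of [P] and [Q] outside [K] is, up to an element of [K], a
    coefficient of [P * Q]. *)
Lemma coefs_in_prime (P Q : {poly R}) :
  coefs_in K (P * Q) -> coefs_in K P \/ coefs_in K Q.
Proof.
move=> hPQ.
have lowest (F : {poly R}) : ~ coefs_in K F ->
    exists l, ~ K F`_l /\ forall i, (i < l)%N -> K F`_i.
  move=> /not_all_ex_not[l0 hl0].
  elim/ltn_ind: l0 hl0 => l IH hl.
  have [[i [il hi]]|hn] := classic (exists i, (i < l)%N /\ ~ K F`_i).
    exact: (IH i).
  by exists l; split=> // i il; apply: NNPP => hi; apply: hn; exists i.
apply: NNPP => /not_or_and[/lowest[a [ha la]] /lowest[b [hb lb]]].
have : K (P`_a * Q`_b).
  have := hPQ (a + b)%N; have alt : (a < (a + b).+1)%N by rewrite ltnS leq_addr.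
  rewrite coefM (bigD1 (Ordinal alt)) //= addKn => hs.
  apply: (@ideal_subK _ _ _
    (- (\sum_(l < (a + b).+1 | l != Ordinal alt) P`_l * Q`_(a + b - l)))) => //.
    by rewrite opprK.
  apply: idealN => //; rewrite big_mkcond; apply: ideal_sum => // l _.
  case: ifP => [la'|_]; last by case: idK.
  have [lta|gta] := ltnP l a; first by apply: idealMl => //; apply: la.
  apply: idealM => //; apply: lb.
  have lna : l != a :> nat by apply: contraNneq la' => e; apply/eqP/val_inj.
  by have := ltn_ord l; lia.
by case/primeK.
Qed.

End CoefsPrime.

(** * Depth and codimension of a ring presented as S modulo I_G^(m) *)

Section QuotientRing.

Variables (k : fieldType) (n : nat) (G : rel 'I_n) (m : nat) (Q : comNzRingType).
Variable pr : {rmorphism {mpoly k[n]} -> Q}.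
Hypothesis pr_surj : forall y, exists x, pr x = y.
Hypothesis ker_pr : forall x, pr x = 0 <-> forall i j, G i j -> edge_ideal m i j x.
Hypotheses (symG : ssrbool.symmetric G) (irrG : irreflexive G).

Lemma preim_ideal (K : Q -> Prop) : is_ideal K -> is_ideal (fun x => K (pr x)).
Proof.
move=> hK; split=> [|x y hx hy|a x hx]; rewrite ?rmorph0 ?rmorphD ?rmorphM.
- by case: hK.
- exact: idealD.
- exact: idealM.
Qed.

Lemma quotient_noetherian : noetherian Q.
Proof.
move=> J; have [s hs] := hilbert_basis (preim_ideal (idealr_is_ideal J)).
exists (map pr s) => y; have [x <-] := pr_surj y.
have hg := ideal_gen_ideal (fun y => y \in map pr s).
split=> [/hs|].
  apply: (ideal_gen_min (preim_ideal hg)) => z zs; apply: mem_ideal_gen.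
  exact: map_f.
apply: (ideal_gen_min (idealr_is_ideal J)) => _ /mapP[z zs ->].
by apply/hs; apply: mem_ideal_gen.
Qed.

(** In a chain of four primes, an element of each prime outside the previous one is regular modulo
    the latter, which [no_regular_triple] excludes. *)
Lemma prime_chain_le2 (M : idealr Q) d : prime_chain M d -> (d <= 2)%N.
Proof.
case=> p [hp _]; rewrite leqNgt; apply/negP => d3.
have pick i : (i < d)%N -> exists s, pr s \in p i.+1 /\ ~ pr s \in p i.
  move=> /hp[_ hn]; apply: NNPP => hne; apply: hn => y yp.
  have [x xy] := pr_surj y; apply: NNPP => ny; apply: hne; exists x.
  by rewrite xy.
have [s1 [h1 n1]] := pick 0%N (ltnW (ltnW d3)).
have [s2 [h2 n2]] := pick 1%N (ltnW d3).
have [s3 [h3 n3]] := pick 2%N d3.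
have [P nzP hP] := alg_dependence m s1 s2 s3 irrG.
have idp i := preim_ideal (idealr_is_ideal (p i)).
have sub i : (i < d)%N -> forall x, pr x \in p i -> pr x \in p i.+1.
  by move=> /hp[h _] x; apply: h.
have reg i s u : ~ pr s \in p i -> pr (s * u) \in p i -> pr u \in p i.
  by rewrite rmorphM /= prime_idealrM => ns /orP[].
have : pr 1 \in p 3%N.
  apply: (@no_regular_triple _ _ (fun x => pr x \in p 0%N) (fun x => pr x \in p 1%N)
    (fun x => pr x \in p 2%N) (fun x => pr x \in p 3%N) s1 s2 s3 P) => //;
    try exact: idp.
  - by apply: sub; apply: ltnW (ltnW d3).
  - by apply: sub; apply: ltnW.
  - exact: sub.
  - by move=> u; apply: reg.
  - by move=> u; apply: reg.
  - by move=> u; apply: reg.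
  - by have /ker_pr -> := hP; rewrite idealr0.
by rewrite rmorph1 idealr1.
Qed.

(** [no_regular_triple] applies to the ideals generated by the first 0, 1, 2 and 3 terms. *)
Lemma regular_seq_le2 (s : seq Q) : regular_seq s -> (size s <= 2)%N.
Proof.
case=> hreg h1; rewrite leqNgt; apply/negP => s3.
pose K i x := ideal_gen (fun z => z \in take i s) (pr x).
have idK i : is_ideal (K i) := preim_ideal (ideal_gen_ideal _).
have [s1 e1] := pr_surj s`_0; have [s2 e2] := pr_surj s`_1.
have [s3' e3] := pr_surj s`_2.
have [P nzP hP] := alg_dependence m s1 s2 s3' irrG.
have sub i x : (i < size s)%N -> K i x -> K i.+1 x.
  move=> hi; apply: (ideal_gen_min (ideal_gen_ideal _)) => y ys; apply: mem_ideal_gen.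
  by rewrite (take_nth 0) // mem_rcons inE ys orbT.
have inK i x : (i < size s)%N -> pr x = s`_i -> K i.+1 x.
  move=> hi e; apply: mem_ideal_gen.
  by rewrite (take_nth 0) // mem_rcons inE e eqxx.
have reg i x u : (i < size s)%N -> pr x = s`_i -> K i (x * u) -> K i u.
  by move=> hi e; rewrite /K rmorphM /= e; apply: hreg.
apply: h1; have : K 3%N 1.
  apply: (@no_regular_triple _ _ (K 0%N) (K 1%N) (K 2%N) (K 3%N) s1 s2 s3' P) => //.
  - by move=> x; apply: sub; apply: ltnW (ltnW s3).
  - by move=> x; apply: sub; apply: ltnW.
  - by move=> x; apply: sub.
  - by apply: inK => //; apply: ltnW (ltnW s3).
  - by apply: inK => //; apply: ltnW.
  - exact: inK.
  - by move=> u; apply: reg => //; apply: ltnW (ltnW s3).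
  - by move=> u; apply: reg => //; apply: ltnW.
  - by move=> u; apply: reg.
  - by have /ker_pr e := hP; rewrite /K e; case: (ideal_gen_ideal (fun z => z \in take 0 s)).
rewrite /K rmorph1; apply: (ideal_gen_min (ideal_gen_ideal _)) => y ys.
by apply: mem_ideal_gen; apply: mem_take ys.
Qed.

Lemma push_prime (K : {mpoly k[n]} -> Prop) :
  is_ideal K -> ~ K 1 -> (forall x y, K (x * y) -> K x \/ K y) ->
  (forall x, pr x = 0 -> K x) ->
  exists q : prime_idealr Q, forall x, pr x \in q <-> K x.
Proof.
move=> hK K1 hp h0; pose P y := exists2 x, pr x = y & K x.
have PE x : P (pr x) <-> K x.
  split=> [[x' e Kx']|Kx]; last by exists x.
  by apply: (@ideal_subK _ _ _ x') => //; apply: h0; rewrite rmorphB e subrr.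
have [||x y|q hq] := @prime_idealr_of Q P.
- split=> [|x y [x' <- hx] [y' <- hy]|a x [x' <- hx]].
  + by exists 0; [rewrite rmorph0|case: hK].
  + by exists (x' + y'); [rewrite rmorphD|apply: idealD].
  + by have [a' <-] := pr_surj a; exists (a' * x'); [rewrite rmorphM|apply: idealM].
- by rewrite -(rmorph1 pr) PE.
- have [x' <-] := pr_surj x; have [y' <-] := pr_surj y.
  by rewrite -rmorphM !PE; apply: hp.
by exists q => x; split=> [/hq/PE|/PE/hq].
Qed.

Section AtMaximal.

Variable M : idealr Q.
Hypothesis maxM : maximal_ideal M.

Let N x := pr x \in M.

Lemma preimN_ideal : is_ideal N.
Proof. exact: preim_ideal (idealr_is_ideal M). Qed.

Lemma preimN_proper : ~ N 1.
Proof. by rewrite /N rmorph1 idealr1. Qed.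

Lemma preimN_inv u : ~ N u -> exists h, N (u * h - 1).
Proof.
move=> /negP/(maximal_inv maxM)[y hy]; have [h e] := pr_surj y.
by exists h; rewrite /N rmorphB rmorphM rmorph1 /= e.
Qed.

Lemma preimN_prime x y : N (x * y) -> N x \/ N y.
Proof.
move=> hxy; apply: NNPP => /not_or_and[nx ny].
have [h hh] := preimN_inv nx; apply: ny.
rewrite (_ : y = h * (x * y) - y * (x * h - 1)); last by ring.
by apply: (idealB preimN_ideal); apply: (idealM _ preimN_ideal).
Qed.

(** Otherwise each P_e has an element outside [N]; the product of their m-th powers lies in I_G^(m),
    hence in the prime ideal [N]. *)
Lemma preimN_edge : exists i j, G i j /\ forall f, edge_ideal 1 i j f -> N f.
Proof.
apply: NNPP => hn.
have [f hf] : exists f : 'I_n * 'I_n -> {mpoly k[n]}, forall e,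
    ~ N (f e) /\ (G e.1 e.2 -> edge_ideal 1 e.1 e.2 (f e)).
  apply: (@fin_all_exists _ (fun=> {mpoly k[n]}) (fun e f =>
    ~ N f /\ (G e.1 e.2 -> edge_ideal 1 e.1 e.2 f))) => -[i j] /=.
  have [gij|ngij] := boolP (G i j); last by exists 1; split=> //; exact: preimN_proper.
  apply: NNPP => hne; apply: hn; exists i, j; split=> // f hf.
  by apply: NNPP => nf; apply: hne; exists f.
have : N (\prod_e f e ^+ m).
  have /ker_pr e : forall i j, G i j -> edge_ideal m i j (\prod_e f e ^+ m).
    move=> i j gij; rewrite (bigD1 (i, j)) //=.
    apply: (idealMl _ (edge_ideal_ideal k m i j)).
    by apply: edge_ideal_exp; case: (hf (i, j)) => _; apply.
  by rewrite /N e idealr0.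
apply: (big_ind (fun x => ~ N x)) => [|x y nx ny /preimN_prime[]//|e _].
  exact: preimN_proper.
elim: m => [|d IH]; first by rewrite expr0; exact: preimN_proper.
by rewrite exprS => /preimN_prime[]//; case: (hf e).
Qed.

Lemma regular_pair_at_maximal : four_cycles G ->
  exists s : seq Q, [/\ regular_seq s, {subset s <= M} & size s = 2%N].
Proof.
move=> cycG; have [i0 [j0 [g0 hsub]]] := preimN_edge.
have ij0 : i0 != j0 by apply: contraTneq g0 => ->; rewrite irrG.
have [p [monp p0 hp]] := common_monic ij0 preimN_ideal preimN_proper preimN_inv hsub.
pose f := sym1 n p; pose g := sym2 n p.
have Nf : N f by apply: (ideal_sum preimN_ideal) => t _; apply: hp.
have Ng : N g.
  apply: (ideal_sum preimN_ideal) => s _; apply: (ideal_sum preimN_ideal) => t _.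
  case: ifP => _; last by case: preimN_ideal.
  by apply: (idealM _ preimN_ideal); apply: hp.
have sM : {subset [:: pr f; pr g] <= M}.
  by move=> x; rewrite !inE => /orP[]/eqP->.
have gen1 y : ideal_gen (fun z => z \in [:: pr f]) y <-> exists c, y = c * pr f.
  rewrite (ideal_gen_rcons [::]); split=> -[c hc]; exists c.
    by apply/eqP; rewrite -subr_eq0; apply/eqP/ideal_gen_nil.
  by apply/ideal_gen_nil; rewrite hc subrr.
exists [:: pr f; pr g]; split=> //; split; last first.
  move=> /(ideal_gen_min (idealr_is_ideal M)) h.
  by have := h sM; rewrite idealr1.
have axis i j a : off [set i] a = 0%N -> off [set i; j] a = 0%N.
  by move=> e; apply/eqP; rewrite -leqn0 -e off_subset // sub1set !inE eqxx.
case=> [|[|//]] y _ /=; have [u <-] := pr_surj y.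
  (* The first element is regular because e_1(y) lies in no P_ij. *)
  rewrite /= -rmorphM => /ideal_gen_nil/ker_pr h; apply/ideal_gen_nil/ker_pr => i j gij.
  apply: (edge_ideal_reg (f := f)); last exact: h.
  by have [a fa /axis ea] := sym1_axis monp p0 i; exists a.
move=> /gen1[c]; have [v <-] := pr_surj c => /eqP.
rewrite -!rmorphM -subr_eq0 -rmorphB => /eqP/ker_pr h.
(* On each edge [u] is a multiple of [f]; the quotients [z e] then glue to one polynomial [w]. *)
have [z hz] : exists z : 'I_n * 'I_n -> {mpoly k[n]}, forall e,
    G e.1 e.2 -> edge_ideal m e.1 e.2 (f * z e - u).
  apply: (@fin_all_exists _ (fun=> {mpoly k[n]}) (fun e z =>
    G e.1 e.2 -> edge_ideal m e.1 e.2 (f * z - u))) => -[i j] /=.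
  have [gij|ngij] := boolP (G i j); last by exists 0.
  have ij : i != j by apply: contraTneq gij => ->; rewrite irrG.
  have [|z hz] := @sym_edge_regular k n p monp p0 m i j u v ij; last by exists z.
  by rewrite (mulrC (sym1 n p)); apply: h.
have [w hw] := glue_edges (z := fun i j => z (i, j)) symG irrG cycG
  (sym1_axis monp p0) (fun i j => hz (i, j)).
apply/gen1; exists (pr w); rewrite -rmorphM; apply/eqP.
rewrite -subr_eq0 -rmorphB; apply/eqP/ker_pr => i j gij.
have hid := edge_ideal_ideal k m i j.
rewrite (_ : _ - _ = - (f * (w - z (i, j)) + (f * z (i, j) - u))); last by ring.
apply: (idealN hid); apply: (idealD hid); last exact: (hz (i, j)).
by apply: (idealM _ hid); apply: hw.
Qed.

(* The chain is P_ij, the polynomials with all their x_j-coefficients in [N],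
   and [N]. *)
Lemma prime_chain2_at_maximal : (0 < m)%N -> prime_chain M 2.
Proof.
move=> m_gt0; have [i [j [gij hsub]]] := preimN_edge.
have ij : i != j by apply: contraTneq gij => ->; rewrite irrG.
have [p [monp p0 hp]] := common_monic ij preimN_ideal preimN_proper preimN_inv hsub.
have hE := edge_ideal_ideal k 1 i j.
have hid := coefs_in_ideal preimN_ideal.
have expand0 f : edge_ideal 1 i j f -> coefs_in N (expand k j f).
  by move=> hf l; apply: hsub; apply: expand_edge.
have kerE f : pr f = 0 -> edge_ideal 1 i j f.
  by move=> /ker_pr/(_ _ _ gij); apply: edge_idealW.
have [||||q0 hq0] := @push_prime (edge_ideal 1 i j) => //.
- by move/hsub; exact: preimN_proper.
- move=> x y hxy; apply: NNPP => /not_or_and[/edge_ideal1PN hx ny].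
  by apply: ny; apply: edge_ideal_reg hx hxy.
have [||||q1 hq1] := @push_prime (fun x => coefs_in N (expand k j x)).
- split=> [|x y hx hy|a x hx]; rewrite ?rmorph0 ?rmorphD ?rmorphM.
  + by case: hid.
  + exact: (idealD hid).
  + exact: (idealM _ hid).
- by rewrite rmorph1 => /(_ 0%N); rewrite coef1; exact: preimN_proper.
- move=> x y; rewrite rmorphM; apply: coefs_in_prime; first exact: preimN_ideal.
  exact: preimN_prime.
- by move=> x /kerE/expand0.
have [||||q2 hq2] := @push_prime N.
- exact: preimN_ideal.
- exact: preimN_proper.
- exact: preimN_prime.
- by rewrite /N => x ->; rewrite idealr0.
exists (fun l => if l is l'.+1 then if l' is 0 then q1 else q2 else q0); split; last first.
  by move=> y; have [x <-] := pr_surj y; apply/idP/idP => [/hq2|/hq2].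
case=> [|[|//]] _; split.
- by move=> y; have [x <-] := pr_surj y => /hq0/expand0/hq1.
(* y_i separates the first two primes: it is constant in x_j and lies in [N], but not in P_ij. *)
- move=> /(_ (pr (subst_var p i))) h; apply: (@subst_var_exp_notin k n p monp i j 1).
  rewrite expr1; apply/hq0/h/hq1 => l; rewrite expand_eval1N // coefC.
  by case: ifP => _; [apply: hp|case: preimN_ideal].
- move=> y; have [x <-] := pr_surj y => /hq1 h; apply/hq2.
  rewrite -(horner_expand j x) horner_coef; apply: (ideal_sum preimN_ideal) => l _.
  by apply: (idealMl _ preimN_ideal); apply: h.
(* y_j lies in [N], but its top coefficient in x_j is 1. *)
- move=> /(_ (pr (subst_var p j))) h.
  have /hq1/(_ (size p).-1) : pr (subst_var p j) \in q1 by apply: h; apply/hq2; apply: hp.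
  rewrite expand_eval1 coef_map -/(lead_coef p) (monicP monp) /= mpolyC1.
  exact: preimN_proper.
Qed.

End AtMaximal.

End QuotientRing.

(** Powers of [y] are regular modulo [x] like [y] itself; induction on [e] then cancels one factor
    [x] at a time. *)
Lemma pow_regular (R : comNzRingType) (x y : R) :
  (forall u, x * u = 0 -> u = 0) ->
  (forall u v, y * u = x * v -> exists u', u = x * u') ->
  forall b e u v, y ^+ b * u = x ^+ e * v -> exists u', u = x ^+ e * u'.
Proof.
move=> hx hy.
have hyb b u v : y ^+ b * u = x * v -> exists u', u = x * u'.
  elim: b u v => [|b IH] u v; first by rewrite mul1r; exists v.
  by rewrite exprS -mulrA => /hy[v' /IH].
move=> b; elim=> [|e IH] u v huv; first by exists u; rewrite mul1r.
have [|u' eu] := hyb b u (x ^+ e * v); first by rewrite huv exprS mulrA.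
have [|u'' eu'] := IH u' v.
  apply/eqP; rewrite -subr_eq0; apply/eqP/hx.
  rewrite (_ : x * _ = y ^+ b * (x * u') - x ^+ e.+1 * v); last by rewrite exprS; ring.
  by rewrite -eu huv subrr.
by exists u''; rewrite eu eu' exprS mulrA.
Qed.

(** * Degree estimates for disjoint edges *)

Section StarObstruction.

Variables (n : nat) (G : rel 'I_n).
Hypotheses (symG : ssrbool.symmetric G) (irrG : irreflexive G).
Implicit Types (T : {set 'I_n}) (w : 'X_{1..n}) (i j s t : 'I_n).

Lemma off_ge1 T w t : t \notin T -> (w t <= off T w)%N.
Proof. by move=> tT; rewrite /off (bigD1 t) //= leq_addr. Qed.

Lemma off_ge2 T w s t : s \notin T -> t \notin T -> s != t -> (w s + w t <= off T w)%N.
Proof.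
move=> sT tT st; rewrite /off (bigD1 s) //= (bigD1 t) /=; last by rewrite tT eq_sym.
by rewrite addnA leq_addr.
Qed.

Lemma set2_inP i j s t : s \in [set i; j] -> t \in [set i; j] -> s != t ->
  [set i; j] = [set s; t].
Proof.
rewrite !inE => /orP[]/eqP-> /orP[]/eqP->; rewrite ?eqxx // => _.
by rewrite setUC.
Qed.

Lemma set2_edge i j s t : G i j -> [set i; j] = [set s; t] -> G s t.
Proof.
move=> gij e.
have ij : i != j by apply: contraTneq gij => ->; rewrite irrG.
have hi : i \in [set s; t] by rewrite -e !inE eqxx.
have hj : j \in [set s; t] by rewrite -e !inE eqxx orbT.
move: hi hj ij gij; rewrite !inE => /orP[]/eqP-> /orP[]/eqP->; rewrite ?eqxx //.
by rewrite symG.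
Qed.

(** Such an edge contains neither [b], since bc is not an edge, nor [d], since it is not cd. *)
Lemma star_off b c d w i j : ~~ G b c -> b != c -> b != d -> c != d ->
  G i j -> [set i; j] != [set c; d] -> c \in [set i; j] ->
  (w b + w d <= off [set i; j] w)%N.
Proof.
move=> nbc bc bd cd gij ne cT; apply: off_ge2 => //.
  apply: contraNN nbc => bT; apply: set2_edge gij _; exact: set2_inP.
by apply: contraNN ne => dT; apply/eqP/set2_inP.
Qed.

Lemma mdeg_ge_mono (k : fieldType) L (g : {mpoly k[n]}) :
  g@_0%MM = 0 -> mono_ideal (fun a => (L <= mdeg a)%N) (g ^+ L).
Proof.
move=> g0; elim: L => [|L IH] a; first by [].
rewrite exprS => /mcoeff_mul_neq0[b [c [gb /IH hc ->]]].
rewrite mdegD -add1n leq_add // lt0n mdeg_eq0.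
by apply: contraNneq gb => ->; rewrite g0.
Qed.

Lemma mdeg_pigeonhole m (a : 'X_{1..n}) : (0 < m)%N -> (n * m < mdeg a)%N ->
  exists t, (m <= a t)%N.
Proof.
move=> m_gt0 h; apply: NNPP => hn; move: h; rewrite ltnNge => /negP; apply.
have -> : (n * m = \sum_(t < n) m)%N by rewrite sum_nat_const card_ord.
rewrite mdegE; apply: leq_sum => t _.
by rewrite leqNgt; apply/negP => ht; apply: hn; exists t; apply: ltnW.
Qed.

End StarObstruction.

(** * From the Cohen-Macaulay property to 4-cycles *)

Section CohenMacaulayCycles.

Variables (k : fieldType) (n : nat) (G : rel 'I_n) (m : nat) (Q : comNzRingType).
Variable pr : {rmorphism {mpoly k[n]} -> Q}.
Hypothesis pr_surj : forall y, exists x, pr x = y.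
Hypothesis ker_pr : forall x, pr x = 0 <-> forall i j, G i j -> edge_ideal m i j x.
Hypotheses (symG : ssrbool.symmetric G) (irrG : irreflexive G).
Hypotheses (m_gt0 : (0 < m)%N) (cmQ : cohen_macaulay_ring Q).

Let neqG i j : G i j -> i != j.
Proof. by apply: contraTneq => ->; rewrite irrG. Qed.

Lemma edge_ideal1_mcoeff0 i j (f : {mpoly k[n]}) : edge_ideal 1 i j f -> f@_0%MM = 0.
Proof.
move=> hf; apply/eqP; apply: contraT => /hf; rewrite /off big1 // => t _.
by rewrite mnm0E.
Qed.

Lemma edge_ideal1_prime i j (f g : {mpoly k[n]}) :
  edge_ideal 1 i j (f * g) -> edge_ideal 1 i j f \/ edge_ideal 1 i j g.
Proof.
move=> hfg; apply: NNPP => /not_or_and[/edge_ideal1PN hf ng].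
by apply: ng; apply: edge_ideal_reg hf hfg.
Qed.

Lemma mcoeff0M (f g : {mpoly k[n]}) : (f * g)@_0%MM = f@_0%MM * g@_0%MM.
Proof. exact: (rmorphM (mcoeff 0%MM)). Qed.

(** The chain formed by P_ab, the prime of the axis of x_a and the ideal of the origin shows that
    the codimension there is at least 2. It equals the depth, so some regular sequence has two first
    elements. *)
Lemma origin_regular_pair a b : G a b -> exists s : seq {mpoly k[n]},
  [/\ size s = 2%N, forall f, f \in s -> f@_0%MM = 0 & regular_seq (map pr s)].
Proof.
move=> gab; have ab := neqG gab.
have kerE x : pr x = 0 -> edge_ideal 1 a b x.
  by move=> /ker_pr/(_ _ _ gab); apply: edge_idealW.
have subE (x : {mpoly k[n]}) : edge_ideal 1 a b x -> edge_ideal 1 a a x.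
  move=> hx c /hx h; apply: leq_trans h _; apply: off_subset.
  by rewrite setUid sub1set !inE eqxx.
have one0 : (1 : {mpoly k[n]})@_0%MM <> 0 by rewrite mcoeff1 eqxx; apply/eqP/oner_neq0.
have [||||q0 hq0] := @push_prime k n Q pr pr_surj (edge_ideal 1 a b) => //.
- exact: edge_ideal_ideal.
- by move/edge_ideal1_mcoeff0.
- exact: edge_ideal1_prime.
have [||||q1 hq1] := @push_prime k n Q pr pr_surj (edge_ideal 1 a a) => //.
- exact: edge_ideal_ideal.
- by move/edge_ideal1_mcoeff0.
- exact: edge_ideal1_prime.
- by move=> x /kerE/subE.
have [||||q2 hq2] := @push_prime k n Q pr pr_surj (fun f => f@_0%MM = 0) => //.
- split=> [|x y hx hy|c x hx]; first by rewrite mcoeff0.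
    by rewrite mcoeffD hx hy addr0.
  by rewrite mcoeff0M hx mulr0.
- move=> x y; rewrite mcoeff0M => /eqP; rewrite mulf_eq0.
  by case/orP=> /eqP; [left|right].
- by move=> x /kerE/edge_ideal1_mcoeff0.
have chain : prime_chain q2 2.
  exists (fun l => if l is l'.+1 then if l' is 0 then q1 else q2 else q0); split=> //.
  case=> [|[|//]] _; split.
  - by move=> y; have [x <-] := pr_surj y => /hq0/subE/hq1.
  - move=> /(_ (pr 'X_b)) h.
    have /hq1/h/hq0/(_ U_(b)%MM) : edge_ideal 1 a a ('X_b : {mpoly k[n]}).
      by apply: edge_idealU; rewrite eq_sym.
    by rewrite mcoeffX eqxx oner_eq0 off_U !inE eqxx orbT => /(_ isT).
  - by move=> y; have [x <-] := pr_surj y => /hq1/edge_ideal1_mcoeff0/hq2.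
  - move=> /(_ (pr 'X_a)) h.
    have /hq2/h/hq1/(_ U_(a)%MM) : ('X_a : {mpoly k[n]})@_0%MM = 0.
      by rewrite mcoeffX mnm1_eq0.
    by rewrite mcoeffX eqxx oner_eq0 off_U !inE eqxx => /(_ isT).
have maxq : maximal_ideal q2.
  move=> J sub y; have [x <-] := pr_surj y => xJ; apply/hq2; apply: NNPP => x0.
  have hJ := preim_ideal pr (idealr_is_ideal J).
  have : pr (x - (x@_0%MM)%:MP) \in J.
    by apply: sub; apply/hq2; rewrite mcoeffB mcoeffC eqxx mulr1 subrr.
  move=> /(idealB hJ xJ); rewrite opprB addrC subrK => cJ.
  have := idealM ((x@_0%MM)^-1%:MP) hJ cJ.
  by rewrite -mpolyCM mulVf ?mpolyC1 ?rmorph1 ?idealr1 //; apply/eqP.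
have [_ /(_ q2 maxq)[d [[[s [[hreg hs1] sM sz]] _] [_ /(_ _ chain) d2]]]] := cmQ.
case: s hreg hs1 sM sz => [|x [|y s]] hreg hs1 sM /= sz; try by rewrite -sz in d2.
have [x' ex] := pr_surj x; have [y' ey] := pr_surj y.
exists [:: x'; y']; split=> //.
  move=> f; rewrite !inE => /orP[]/eqP->; apply/hq2; rewrite ?ex ?ey; apply: sM.
    by rewrite inE eqxx.
  by rewrite !inE eqxx orbT.
rewrite /= ex ey; split; last first.
  move=> h; apply: hs1; apply: (ideal_gen_min (ideal_gen_ideal _)) h => z zs.
  by apply: mem_ideal_gen; move: zs; rewrite !inE => /orP[]->; rewrite ?orbT.
by case=> [|[|//]] z _; [apply: (hreg 0%N)|apply: (hreg 1%N)].
Qed.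

(* For the weight [w], the edge [cd] is isolated among the edges whose ideal
   does not contain ['X_[w]], and [ab] is another one. [Rep g] says that [g]
   times the family ['X_[w]] on [cd], 0 elsewhere, comes from one polynomial. *)
Lemma star_obstruction a b c d : (2 < m)%N ->
  G a b -> G c d -> [disjoint [set a; b] & [set c; d]] ->
  ~~ G b c -> ~~ G b d -> False.
Proof.
move=> m3 gab gcd dis nbc nbd.
have ab := neqG gab; have cd := neqG gcd.
have notin x : x \in [set a; b] -> x \notin [set c; d] by move=> h; rewrite (disjointFr dis h).
have /norP[ac ad] : ~~ ((a == c) || (a == d)).
  by have := notin a; rewrite !inE eqxx; apply.
have /norP[bc bd] : ~~ ((b == c) || (b == d)).
  by have := notin b; rewrite !inE eqxx orbT; apply.
(* The degree of x^w is 2 off {a, b} and m - 1 off {c, d}, both below [m] because [m] is at least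
   3. *)
pose w : 'X_{1..n} := (U_(b) *+ m.-1 + (U_(c) + U_(d)))%MM.
have wE t : w t = ((b == t) * m.-1 + ((c == t) + (d == t)))%N.
  by rewrite /w !mnmDE mulmnE !mnm1E.
have wa : w a = 0%N by rewrite wE ![_ == a]eq_sym (negbTE ab) (negbTE ac) (negbTE ad).
have wb : w b = m.-1 by rewrite wE eqxx ![_ == b]eq_sym (negbTE bc) (negbTE bd) mul1n addn0.
have wc : w c = 1%N by rewrite wE eqxx (negbTE bc) eq_sym (negbTE cd).
have wd : w d = 1%N by rewrite wE eqxx (negbTE bd) (negbTE cd).
have degw : mdeg w = m.+1 by rewrite /w !mdegD mdegMn !mdeg1; clear -m3; lia.
have offab : off [set a; b] w = 2%N by have := off_set2 w ab; rewrite wa wb degw; clear -m3; lia.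
have offcd : off [set c; d] w = m.-1 by have := off_set2 w cd; rewrite wc wd degw; clear -m3; lia.
pose Rep (g : {mpoly k[n]}) := exists f, edge_ideal m c d (f - g * 'X_[w]) /\
  forall i j, G i j -> [set i; j] != [set c; d] -> edge_ideal m i j f.
have hid (i j : 'I_n) := edge_ideal_ideal k m i j.
have idR : is_ideal Rep.
  split.
  - exists 0; rewrite mul0r subr0; split=> [|i j _ _]; first by case: (hid c d).
    by case: (hid i j).
  - move=> x y [f [h1 h2]] [g [h3 h4]]; exists (f + g); split=> [|i j gij ne].
      rewrite (_ : _ - _ = (f - x * 'X_[w]) + (g - y * 'X_[w])); last by ring.
      exact: (idealD (hid c d)).
    by apply: (idealD (hid i j)); [apply: h2|apply: h4].
  - move=> e x [f [h1 h2]]; exists (e * f); split=> [|i j gij ne].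
      rewrite -mulrA -mulrBr; exact: (idealM _ (hid c d)).
    by apply: (idealM _ (hid i j)); apply: h2.
(* For t outside {c, d}, x_t^m makes the family 0. For t in {c, d}, x_t^m x^w represents it: on
   another edge through t, x^w has degree at least (m - 1) + 1 by [star_off]. *)
have RepX t : Rep ('X_[U_(t) *+ m]).
  have offX i j : t \notin [set i; j] ->
      edge_ideal m i j ('X_[U_(t) *+ m] * 'X_[w] : {mpoly k[n]}).
    move=> tT; apply: (idealMl _ (hid i j)); apply: edge_idealX.
    by apply: leq_trans (off_ge1 _ tT); rewrite mulmnE mnm1E eqxx mul1n.
  have [tcd|tcd] := boolP (t \in [set c; d]); last first.
    exists 0; rewrite sub0r; split=> [|i j _ _]; last by case: (hid i j).
    by apply: (idealN (hid c d)); apply: offX.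
  exists ('X_[U_(t) *+ m] * 'X_[w]); rewrite subrr.
  split=> [|i j gij ne]; first by case: (hid c d).
  have [tT|tT] := boolP (t \in [set i; j]); last exact: offX.
  apply: (idealM _ (hid i j)); apply: edge_idealX.
  have mE : m = (w b + 1)%N by rewrite wb; clear -m3; lia.
  move: tcd tT; rewrite !inE; case/orP=> /eqP-> tT; rewrite mE.
    by rewrite -wd; apply: (star_off symG irrG w nbc bc bd cd gij ne); rewrite !inE.
  rewrite -wc; apply: (star_off symG irrG w nbd bd bc _ gij _); rewrite ?inE //.
    by rewrite eq_sym.
  by rewrite [X in _ != X]setUC.
(* A monomial of degree at least [L] is divisible by some x_t^m. *)
pose L := (n * m).+1.
have RepL (g : {mpoly k[n]}) : g@_0%MM = 0 -> Rep (g ^+ L).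
  move=> /(mdeg_ge_mono (L := L)) h; rewrite (mpolyE (g ^+ L)).
  apply: (ideal_sum idR) => e; rewrite mcoeff_msupp => /h he.
  rewrite -mul_mpolyC; apply: (idealM _ idR).
  have [t ht] := mdeg_pigeonhole m_gt0 he.
  have le : (U_(t) *+ m <= e)%MM.
    apply/mnm_lepP => i; rewrite mulmnE mnm1E; case: (t =P i) => [<-|_] //.
    by rewrite mul1n.
  by rewrite -(submK le) mpolyXD; apply: (idealM _ idR).
have [s [sz s0 [hreg _]]] := origin_regular_pair gab.
case: s sz s0 hreg => [|x [|y [|//]]] //= _ s0 hreg.
have x0 : x@_0%MM = 0 by apply: s0; rewrite inE eqxx.
have y0 : y@_0%MM = 0 by apply: s0; rewrite !inE eqxx orbT.
have regx u : pr x * u = 0 -> u = 0.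
  by move=> h; apply/ideal_gen_nil; apply: (hreg 0%N) => //=; apply/ideal_gen_nil.
have gen1 z : ideal_gen (fun z => z \in [:: pr x]) z <-> exists c, z = c * pr x.
  rewrite (ideal_gen_rcons [::]); split=> -[e he]; exists e.
    by apply/eqP; rewrite -subr_eq0; apply/eqP/ideal_gen_nil.
  by apply/ideal_gen_nil; rewrite he subrr.
have regy u v : pr y * u = pr x * v -> exists u', u = pr x * u'.
  move=> h; have /gen1[e ->] : ideal_gen (fun z => z \in [:: pr x]) u.
    by apply: (hreg 1%N) => //=; apply/gen1; exists v; rewrite h mulrC.
  by exists e; rewrite mulrC.
have [r1 [h1 h1']] := RepL _ x0; have [r2 [h2 h2']] := RepL _ y0.
(* On cd both sides are [x ^+ L * y ^+ L * 'X_[w]], on every other edge both are 0. Regularity then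
   gives [r1 = x ^+ L * r] in [Q], and [r] represents the family itself. *)
have e12 : pr y ^+ L * pr r1 = pr x ^+ L * pr r2.
  apply/eqP; rewrite -subr_eq0 -!rmorphXn -!rmorphM -rmorphB; apply/eqP/ker_pr => i j gij.
  have [e|ne] := eqVneq [set i; j] [set c; d].
    rewrite /edge_ideal e -/(edge_ideal m c d _).
    rewrite (_ : _ - _ = y ^+ L * (r1 - x ^+ L * 'X_[w]) - x ^+ L * (r2 - y ^+ L * 'X_[w])).
      by apply: (idealB (hid c d)); apply: (idealM _ (hid c d)).
    by ring.
  by apply: (idealB (hid i j)); apply: (idealM _ (hid i j)); [apply: h1'|apply: h2'].
have [u eu] := pow_regular regx regy e12.
have [r er] := pr_surj u.
have hr : forall i j, G i j -> edge_ideal m i j (r1 - x ^+ L * r).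
  by apply/ker_pr; rewrite rmorphB rmorphM rmorphXn /= er eu subrr.
(* If [x] lay in P_ij, then [x ^+ m] would kill the class of x_i^m x_j^m, which lies in the ideals
   of all other edges but not in P_ij^m. *)
have nx i j : G i j -> ~ edge_ideal 1 i j x.
  move=> gij hx; have ij := neqG gij.
  have regxm l v : pr x ^+ l * v = 0 -> v = 0.
    by elim: l => [|l IH]; rewrite ?mul1r // exprS -mulrA => /regx/IH.
  have : pr ('X_[U_(i) *+ m] * 'X_[U_(j) *+ m]) = 0.
    apply: (regxm m); rewrite -rmorphXn -rmorphM; apply/ker_pr => i' j' gij'.
    have Xm t : t \notin [set i'; j'] -> edge_ideal m i' j' ('X_[U_(t) *+ m] : {mpoly k[n]}).
      move=> tT; apply: edge_idealX; apply: leq_trans (off_ge1 _ tT).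
      by rewrite mulmnE mnm1E eqxx mul1n.
    have [iT|iT] := boolP (i \in [set i'; j']); last first.
      by apply: (idealM _ (hid _ _)); apply: (idealMl _ (hid _ _)); apply: Xm.
    have [jT|jT] := boolP (j \in [set i'; j']); last first.
      by apply: (idealM _ (hid _ _)); apply: (idealM _ (hid _ _)); apply: Xm.
    apply: (idealMl _ (hid _ _)); rewrite /edge_ideal (set2_inP iT jT ij).
    exact: edge_ideal_exp.
  move/ker_pr/(_ _ _ gij)/(_ (U_(i) *+ m + U_(j) *+ m)%MM).
  rewrite -mpolyXD mcoeffX eqxx oner_eq0 => /(_ isT); rewrite leqNgt => /negP; apply.
  rewrite /off big1 // => t; rewrite !inE negb_or => /andP[ti tj].
  by rewrite mnmDE !mulmnE !mnm1E ![_ == t]eq_sym (negbTE ti) (negbTE tj).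
have regE i j v : G i j -> edge_ideal m i j (x ^+ L * v) -> edge_ideal m i j v.
  move=> gij; have hx := edge_ideal1PN (nx _ _ gij).
  by elim: (L) => [|l IH]; rewrite ?mul1r // exprS -mulrA => /(edge_ideal_reg hx)/IH.
(* The edge ab forces the coefficient of [r] at [w] to be 0, and cd forces it to be 1. *)
have rab : r@_w = 0.
  have ne : [set a; b] != [set c; d].
    apply: contraNneq (notin a _) => [<-|]; first by rewrite !inE eqxx.
    by rewrite !inE eqxx.
  have hab : edge_ideal m a b r.
    apply: regE => //; rewrite (_ : _ * _ = r1 - (r1 - x ^+ L * r)); last by ring.
    by apply: (idealB (hid a b)); [apply: h1'|apply: hr].
  by apply/eqP; apply: contraT => /hab; rewrite offab; clear -m3; lia.
have hcd : edge_ideal m c d ('X_[w] - r).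
  apply: regE => //.
  rewrite (_ : _ * _ = (r1 - x ^+ L * r) - (r1 - x ^+ L * 'X_[w])); last by ring.
  by apply: (idealB (hid c d)) => //; apply: hr.
have := hcd w; rewrite mcoeffB rab mcoeffX eqxx subr0 oner_eq0 offcd => /(_ isT).
clear -m3; lia.
Qed.

Lemma four_cycles_of_cm : (2 < m)%N -> four_cycles G.
Proof.
move=> m3 a b c d gab gcd dis; apply: NNPP => /not_or_and[n1 n2].
have dis' : [disjoint [set c; d] & [set a; b]] by rewrite disjoint_sym.
have disba : [disjoint [set b; a] & [set c; d]] by rewrite setUC.
have disdc : [disjoint [set d; c] & [set a; b]] by rewrite setUC.
have gba : G b a by rewrite symG.
have gdc : G d c by rewrite symG.
have nand (x y : bool) : ~ (x /\ y) -> ~~ x \/ ~~ y.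
  by case: x y => -[] h; [case: h|right|left|left].
(* In each case the two missing edges share a vertex, which takes the role of [b] in
   [star_obstruction]. *)
have [nac|nbd] := nand _ _ n1; have [nad|nbc] := nand _ _ n2.
- exact: (star_obstruction m3 gba gcd disba nac nad).
- by apply: (star_obstruction m3 gdc gab disdc); rewrite symG.
- by apply: (star_obstruction m3 gcd gab dis'); rewrite symG.
- exact: (star_obstruction m3 gab gcd dis nbc nbd).
Qed.

End CohenMacaulayCycles.

(** * Passage from one exponent to all exponents *)

Theorem corollary2p5 (k : fieldType) (n : nat) (hn : (3 <= n)%N)
    (G : rel 'I_n) (hG : simple_graph G) :
  (exists m : nat, (3 <= m)%N /\ cohen_macaulay_ideal (symbolic_power k G m)) ->
  forall m : nat, (1 <= m)%N -> cohen_macaulay_ideal (symbolic_power k G m).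
Proof.
case: hG => symG irrG isoG.
have pi_surj (J : idealr {mpoly k[n]}) y : exists x, \pi_({ideal_quot J}) x = y.
  by exists (repr y); rewrite reprK.
have ker_pi (J : idealr {mpoly k[n]}) m : (forall x, x \in J <-> symbolic_power k G m x) ->
    forall x, \pi_({ideal_quot J}) x = 0 <-> forall i j, G i j -> edge_ideal m i j x.
  move=> hJ x; rewrite -symbolic_powerE -hJ -[x in x \in J]subr0 Quotient.idealrBE.
  by split=> [e|/eqP ->]; rewrite ?e ?rmorph0.
case=> m [m3 [J [hJ cmJ]]] m' m'1.
(* The 4-cycle condition does not involve the exponent, so it carries over from [m] to [m']. *)
have cycG : four_cycles G.
  apply: (four_cycles_of_cm (pi_surj J) (ker_pi J m hJ) symG irrG _ cmJ m3).
  exact: leq_trans m3.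
have hI : is_ideal (fun x => symbolic_power k G m' x).
  split=> [|x y /symbolic_powerE hx /symbolic_powerE hy|a x /symbolic_powerE hx];
    apply/symbolic_powerE => i j gij; have hid := edge_ideal_ideal k m' i j.
  - by case: hid.
  - by apply: (idealD hid); [apply: hx|apply: hy].
  - by apply: (idealM _ hid); apply: hx.
have h1 : ~ symbolic_power k G m' 1.
  have [j gij] := isoG (Ordinal (ltnW (ltnW hn))).
  move=> /symbolic_powerE/(_ _ _ gij)/(edge_idealW m'1)/edge_ideal1_mcoeff0/eqP.
  by rewrite mcoeff1 eqxx oner_eq0.
have [J' hJ'] := idealr_of hI h1; exists J'; split=> //; split.
  exact: (quotient_noetherian (pi_surj J')).
have surj' := pi_surj J'; have ker' := ker_pi J' m' hJ'.
move=> M maxM; exists 2%N; split; split.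
- exact: (regular_pair_at_maximal surj' ker' symG irrG maxM cycG).
- by move=> s hs _; apply: (regular_seq_le2 surj' ker' irrG).
- exact: (prime_chain2_at_maximal surj' ker' irrG maxM m'1).
- by move=> e; apply: (prime_chain_le2 surj' ker' irrG).
Qed.
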